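(* For $\tau\in\mathbb{H}^2$ let $q=e^{2\pi i\tau}$ and $$W=\left\{\frac{\eta(2\tau)\eta^2(3\tau)}{\eta^2(\tau)\eta(6\tau)}\right\}^4=\left\{\frac{(q^2;q^2)_\infty(q^3;q^3)_\infty^2}{(q;q)_\infty^2(q^6;q^6)_\infty}\right\}^4.$$ Then $$q\frac{dW}{dq}=\frac{(q^2;q^2)_\infty^7(q^3;q^3)_\infty^7}{(q;q)_\infty^5(q^6;q^6)_\infty^5}\,(W-1),\qquad\text{equivalently}\qquad \frac{dW}{d\tau}=2\pi i\,\frac{\eta^7(2\tau)\eta^7(3\tau)}{\eta^5(\tau)\eta^5(6\tau)}\,(W-1).$$
   Context: $\mathbb{H}^2$ is the upper half-plane; $q=\exp(2\pi i\tau)$; $(q^k;q^k)_\infty=\prod_{n\ge1}(1-q^{kn})$; the Dedekind eta function is $\eta(\tau)=q^{1/24}(q;q)_\infty$. The derivative $q\,d/dq$ is understood as $\frac{1}{2\pi i}\frac{d}{d\tau}$. *)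

(* Defs.v *)
From Stdlib Require Import Reals Lra ClassicalEpsilon.
Open Scope R_scope.

Definition Cx : Type := (R * R)%type.
Definition RtoC (x : R) : Cx := (x, 0).
Definition Czero : Cx := (0, 0).
Definition Cone : Cx := (1, 0).
Definition Ci : Cx := (0, 1).
Definition Cre (z : Cx) : R := fst z.
Definition Cim (z : Cx) : R := snd z.
Definition Cadd (z w : Cx) : Cx := (fst z + fst w, snd z + snd w).
Definition Copp (z : Cx) : Cx := (- fst z, - snd z).
Definition Csub (z w : Cx) : Cx := Cadd z (Copp w).
Definition Cmul (z w : Cx) : Cx :=
  (fst z * fst w - snd z * snd w, fst z * snd w + snd z * fst w).
Definition Cinv (z : Cx) : Cx :=
  let d := fst z ^ 2 + snd z ^ 2 in (fst z / d, - snd z / d).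
Definition Cdiv (z w : Cx) : Cx := Cmul z (Cinv w).
Fixpoint Cpow (z : Cx) (n : nat) : Cx :=
  match n with O => Cone | S m => Cmul z (Cpow z m) end.
Definition Cnorm (z : Cx) : R := sqrt (fst z ^ 2 + snd z ^ 2).
Definition Cexp (z : Cx) : Cx := (exp (fst z) * cos (snd z), exp (fst z) * sin (snd z)).

Definition Cseq_cv (u : nat -> Cx) (l : Cx) : Prop :=
  forall eps : R, eps > 0 -> exists N : nat, forall n : nat, (n >= N)%nat ->
    Cnorm (Csub (u n) l) < eps.
Definition Clim (u : nat -> Cx) : Cx :=
  epsilon (inhabits Czero) (fun l => Cseq_cv u l).

Definition qexp (tau : Cx) : Cx := Cexp (Cmul (RtoC (2 * PI)) (Cmul Ci tau)).

Fixpoint qpoch_partial (q : Cx) (N : nat) : Cx :=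
  match N with
  | O => Cone
  | S M => Cmul (qpoch_partial q M) (Csub Cone (Cpow q (S M)))
  end.

Definition qpoch_inf (tau : Cx) : Cx := Clim (qpoch_partial (qexp tau)).

Definition eta (tau : Cx) : Cx :=
  Cmul (Cexp (Cmul (RtoC (2 * PI / 24)) (Cmul Ci tau))) (qpoch_inf tau).

Definition C_derivable_lim (f : Cx -> Cx) (z L : Cx) : Prop :=
  forall eps : R, eps > 0 -> exists delta : R, delta > 0 /\
    forall h : Cx, h <> Czero -> Cnorm h < delta ->
      Cnorm (Csub (Cdiv (Csub (f (Cadd z h)) (f z)) h) L) < eps.

Definition Cscale (k : R) (tau : Cx) : Cx := Cmul (RtoC k) tau.

Definition W (tau : Cx) : Cx :=
  Cpow (Cdiv (Cmul (eta (Cscale 2 tau)) (Cpow (eta (Cscale 3 tau)) 2))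
             (Cmul (Cpow (eta tau) 2) (eta (Cscale 6 tau)))) 4.

(* Main.v *)
(* With f_k = (q^k; q^k)_oo, phi(q) = sum_n (-1)^n q^(n^2) = f_1^2 / f_2 and chi = phi(q^3) = f_3^2 / f_6 one has
   W = (chi / phi)^4, so that W is differentiated term by term through its theta series. Everything else
   follows from one addition formula: for T(z) = sum_n (-1)^n p^(n(n-1)/2) e^(nz), splitting a double
   series by parity gives T(b+a) T(b-a) = e^b (E(a) O(b) - O(a) E(b)) with two auxiliary theta series E, O.

   (1) The four-point Pluecker relation for these 2x2 minors, with p = q^3 and the points 0, i pi, Q, Q + i pi
   where e^Q = q, becomes W - 1 = 8 q f_2 f_6^5 / (f_1^5 f_3) by the triple product.

   (2) Let S = - (log T)''. Expanding the addition formula to second order at a = 0 shows that S is a Moebius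
   function of E / O, whence S(a) - S(b) = T'(0)^2 e^a T(b+a) T(b-a) / (T(a) T(b))^2 with T'(0) = - (p; p)_oo^3.
   With p = q^6 this evaluates S(Q) - S(3Q) as q f_2^4 f_6^4 / (f_1 f_3)^2. The heat equation identifies
   q phi'/phi with - S(Q) for p = q^2 and q chi'/chi with - 3 S(3Q) for p = q^6, and trisecting the product
   for T writes the former in terms of p = q^6; hence q W'/W = 8 (S(Q) - S(3Q)) for p = q^6. *)

From Stdlib Require Import Reals Lra Lia ZArith ClassicalEpsilon FunctionalExtensionality.
From Coquelicot Require Import Coquelicot.
Require Import Defs.
Open Scope R_scope.
Open Scope C_scope.

(** * Limits and series of complex numbers *)

(** All parameters are logarithms: the nome is e^P, the argument is e^z, and tau enters through Q =
    2 pi i tau. Thus q^(1/24) and the half-integral powers p^(n^2/2) involve no choice of branch, -1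
    is e^[iPI], and quasi-periods are additive shifts. No theory of complex differentiation is
    developed. Its place is taken by expansions f(h) = a0 + a1 h + a2 h^2 + O(h^3), whose
    coefficients are unique and compatible with products and inverses. The heat equation then
    compares coefficients of one Gaussian series, moved in its linear or in its quadratic exponent.
    The function S is handled as T^2 S, so that nothing is divided by a theta value that may vanish.
    The factor 8 arises twice, for different reasons. Trisection gives S(Q) + S(3Q) + S(5Q) with
    S(5Q) = S(Q), hence q W'/W = 4 (2 S(Q) + S(3Q) - 3 S(3Q)); in W - 1 it is the cube of 1 -
    e^[iPI] = 2. Both sides of the differential equation come out as 8 q f_2^8 f_3^6 / f_1^10. *)

(* Convertible with [Cseq_cv], but stated with Coquelicot's operations. *)
Definition cv (u : nat -> C) (l : C) : Prop :=
  forall eps : R, (eps > 0)%R -> exists N : nat, forall n : nat, (n >= N)%nat ->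
    (Cmod (u n - l) < eps)%R.

Lemma Cmod_minus_sym (x y : C) : Cmod (x - y) = Cmod (y - x).
Proof. rewrite <- Cmod_opp. f_equal. ring. Qed.

Lemma Cmod_triangle_minus (x y : C) : (Cmod (x - y) <= Cmod x + Cmod y)%R.
Proof. rewrite <- (Cmod_opp y). apply Cmod_triangle. Qed.

Lemma Cmod_sub_trans (x y z : C) : (Cmod (x - z) <= Cmod (x - y) + Cmod (y - z))%R.
Proof. replace (x - z) with ((x - y) + (y - z)) by ring. apply Cmod_triangle. Qed.

Lemma Cmod_components (z : C) : (Rabs (fst z) <= Cmod z)%R /\ (Rabs (snd z) <= Cmod z)%R.
Proof.
  pose proof (Rmax_Cmod z). pose proof (Rmax_l (Rabs (fst z)) (Rabs (snd z))).
  pose proof (Rmax_r (Rabs (fst z)) (Rabs (snd z))). lra.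
Qed.

Lemma Cmod_small_eq (x y : C) : (forall eps : R, (eps > 0)%R -> (Cmod (x - y) < eps)%R) -> x = y.
Proof.
  intros H. destruct (Req_dec (Cmod (x - y)) 0) as [E|E].
  - apply Cmod_eq_0 in E. replace x with ((x - y) + y) by ring. rewrite E. ring.
  - pose proof (Cmod_ge_0 (x - y)). specialize (H (Cmod (x - y))). lra.
Qed.

Lemma cv_unique (u : nat -> C) (l l' : C) : cv u l -> cv u l' -> l = l'.
Proof.
  intros H H'. apply Cmod_small_eq. intros eps He.
  destruct (H (eps / 2)%R) as [N HN]; [lra|]. destruct (H' (eps / 2)%R) as [N' HN']; [lra|].
  specialize (HN (N + N')%nat ltac:(lia)). specialize (HN' (N + N')%nat ltac:(lia)).
  pose proof (Cmod_sub_trans l (u (N + N')%nat) l'). rewrite (Cmod_minus_sym l (u (N + N')%nat)) in H0. lra.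
Qed.

Lemma cv_ext_loc (u v : nat -> C) (l : C) (K : nat) :
  (forall n, (n >= K)%nat -> u n = v n) -> cv u l -> cv v l.
Proof.
  intros E H eps He. destruct (H eps He) as [N HN]. exists (N + K)%nat. intros n Hn.
  rewrite <- E by lia. apply HN. lia.
Qed.

Lemma cv_ext (u v : nat -> C) (l : C) : (forall n, u n = v n) -> cv u l -> cv v l.
Proof. intros E. apply (cv_ext_loc u v l 0). auto. Qed.

Lemma cv_const (l : C) : cv (fun _ => l) l.
Proof. intros eps He. exists O. intros. replace (l - l) with (Complex.RtoC 0) by ring. rewrite Cmod_0. lra. Qed.

Lemma cv_subseq (u : nat -> C) (l : C) (phi : nat -> nat) :
  (forall n, (phi n >= n)%nat) -> cv u l -> cv (fun n => u (phi n)) l.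
Proof.
  intros Hp H eps He. destruct (H eps He) as [N HN]. exists N. intros n Hn.
  apply HN. specialize (Hp n). lia.
Qed.

Lemma cv_plus (u v : nat -> C) (a b : C) : cv u a -> cv v b -> cv (fun n => u n + v n) (a + b).
Proof.
  intros H H' eps He.
  destruct (H (eps / 2)%R) as [N HN]; [lra|]. destruct (H' (eps / 2)%R) as [N' HN']; [lra|].
  exists (N + N')%nat. intros n Hn.
  specialize (HN n ltac:(lia)). specialize (HN' n ltac:(lia)).
  replace (u n + v n - (a + b)) with ((u n - a) + (v n - b)) by ring.
  eapply Rle_lt_trans; [apply Cmod_triangle|lra].
Qed.

Lemma cv_zero_mult (u v : nat -> C) (B : R) :
  (forall n, (Cmod (u n) <= B)%R) -> cv v 0 -> cv (fun n => u n * v n) 0.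
Proof.
  intros Hu H eps He.
  assert (HB : (0 <= B)%R) by (eapply Rle_trans; [apply Cmod_ge_0|apply (Hu O)]).
  destruct (H (eps / (B + 1))%R) as [N HN]. { apply Rdiv_lt_0_compat; lra. }
  exists N. intros n Hn. specialize (HN n Hn).
  replace (v n - 0) with (v n) in HN by ring. replace (u n * v n - 0) with (u n * v n) by ring.
  rewrite Cmod_mult. pose proof (Cmod_ge_0 (v n)).
  apply Rle_lt_trans with ((B + 1) * Cmod (v n))%R.
  - apply Rmult_le_compat_r; auto. specialize (Hu n). lra.
  - replace eps with ((B + 1) * (eps / (B + 1)))%R by (field; lra).
    apply Rmult_lt_compat_l; lra.
Qed.

Lemma cv_bounded (u : nat -> C) (l : C) : cv u l -> exists B, forall n, (Cmod (u n) <= B)%R.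
Proof.
  intros H. destruct (H 1%R) as [N HN]; [lra|].
  assert (Hf : forall K, exists B, forall n, (n < K)%nat -> (Cmod (u n) <= B)%R).
  { induction K as [|K [B HB]]. exists 0%R; intros; lia.
    exists (Rmax B (Cmod (u K))). intros n Hn. destruct (Nat.eq_dec n K) as [->|].
    apply Rmax_r. eapply Rle_trans; [apply HB; lia|apply Rmax_l]. }
  destruct (Hf N) as [B HB]. exists (Rmax B (Cmod l + 1)). intros n.
  destruct (le_lt_dec N n).
  - eapply Rle_trans; [|apply Rmax_r]. specialize (HN n ltac:(lia)).
    replace (u n) with ((u n - l) + l) by ring. eapply Rle_trans; [apply Cmod_triangle|lra].
  - eapply Rle_trans; [apply HB; lia|apply Rmax_l].
Qed.

Lemma cv_minus_zero (u : nat -> C) (l : C) : cv u l <-> cv (fun n => u n - l) 0.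
Proof.
  split; intros H eps He; destruct (H eps He) as [N HN]; exists N; intros n Hn;
  specialize (HN n Hn); replace (u n - l - 0) with (u n - l) in * by ring; auto.
Qed.

Lemma cv_mult (u v : nat -> C) (a b : C) : cv u a -> cv v b -> cv (fun n => u n * v n) (a * b).
Proof.
  intros H H'. destruct (cv_bounded u a H) as [B HB]. apply cv_minus_zero.
  apply cv_ext with (fun n => u n * (v n - b) + b * (u n - a)). { intros; ring. }
  replace (Complex.RtoC 0) with (0 + 0) by ring. apply cv_plus.
  - apply cv_zero_mult with B; auto. now apply cv_minus_zero in H'.
  - apply cv_zero_mult with (Cmod b). intros; lra. now apply cv_minus_zero in H.
Qed.

Lemma cv_scal (u : nat -> C) (a k : C) : cv u a -> cv (fun n => k * u n) (k * a).
Proof. intros H. apply cv_mult; auto. apply cv_const. Qed.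

Lemma cv_opp (u : nat -> C) (a : C) : cv u a -> cv (fun n => - u n) (- a).
Proof.
  intros H. replace (- a) with ((-1) * a) by ring.
  apply cv_ext with (fun n => (-1) * u n). intros; ring. now apply cv_scal.
Qed.

Lemma cv_minus (u v : nat -> C) (a b : C) : cv u a -> cv v b -> cv (fun n => u n - v n) (a - b).
Proof. intros. apply cv_plus; auto. now apply cv_opp. Qed.

Lemma cv_inv (u : nat -> C) (a : C) (c : R) :
  (0 < c)%R -> (forall n, (c <= Cmod (u n))%R) -> a <> 0 -> cv u a -> cv (fun n => / u n) (/ a).
Proof.
  intros Hc Hu Ha H. apply cv_minus_zero.
  assert (Hn : forall n, u n <> 0). { intros n E. specialize (Hu n). rewrite E, Cmod_0 in Hu. lra. }
  apply cv_ext with (fun n => (- / a * / u n) * (u n - a)).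
  { intros n. field. split; auto. }
  apply cv_zero_mult with (Cmod (- / a) * / c)%R; [|now apply cv_minus_zero in H].
  intros n. rewrite Cmod_mult. apply Rmult_le_compat_l. apply Cmod_ge_0.
  rewrite Cmod_inv by auto. apply Rinv_le_contravar; auto.
Qed.

Lemma cv_lower_bound (u : nat -> C) (a : C) (c : R) :
  (forall n, (c <= Cmod (u n))%R) -> cv u a -> (c <= Cmod a)%R.
Proof.
  intros Hu H. apply Rnot_lt_le. intros Hlt.
  destruct (H (c - Cmod a)%R) as [N HN]; [lra|]. specialize (HN N ltac:(lia)). specialize (Hu N).
  replace (u N) with ((u N - a) + a) in Hu by ring.
  pose proof (Cmod_triangle (u N - a) a). lra.
Qed.

Lemma cv_upper_bound (u : nat -> C) (a : C) (c : R) :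
  (forall n, (Cmod (u n) <= c)%R) -> cv u a -> (Cmod a <= c)%R.
Proof.
  intros Hu H. apply Rnot_lt_le. intros Hlt.
  destruct (H (Cmod a - c)%R) as [N HN]; [lra|]. specialize (HN N ltac:(lia)). specialize (Hu N).
  pose proof (Cmod_sub_trans a (u N) 0). rewrite (Cmod_minus_sym a (u N)) in H0.
  replace (a - 0) with a in H0 by ring. replace (u N - 0) with (u N) in H0 by ring. lra.
Qed.

Lemma cv_Cauchy (u : nat -> C) :
  (forall eps : R, (eps > 0)%R -> exists N : nat, forall n m : nat, (n >= N)%nat -> (m >= N)%nat ->
    (Cmod (u n - u m) < eps)%R) -> exists l, cv u l.
Proof.
  intros H.
  pose proof Cmod_components as Hc.
  destruct (Rcomplete.R_complete (fun n => fst (u n))) as [a Ha].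
  { intros eps He. destruct (H eps He) as [N HN]. exists N. intros n m Hn Hm.
    unfold Rdist. eapply Rle_lt_trans; [|apply (HN n m); auto].
    destruct (Hc (u n - u m)) as [A _]. exact A. }
  destruct (Rcomplete.R_complete (fun n => snd (u n))) as [b Hb].
  { intros eps He. destruct (H eps He) as [N HN]. exists N. intros n m Hn Hm.
    unfold Rdist. eapply Rle_lt_trans; [|apply (HN n m); auto].
    destruct (Hc (u n - u m)) as [_ A]. exact A. }
  exists (a, b). intros eps He.
  destruct (Ha (eps / 2)%R) as [N HN]; [lra|]. destruct (Hb (eps / 2)%R) as [M HM]; [lra|].
  exists (N + M)%nat. intros n Hn.
  specialize (HN n ltac:(lia)). specialize (HM n ltac:(lia)). unfold Rdist in *.
  pose proof (Cmod_2Rmax (u n - (a, b))) as Hm.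
  set (x := fst (u n - (a, b))) in *. set (y := snd (u n - (a, b))) in *.
  assert (Hx : (Rabs x < eps / 2)%R) by exact HN. assert (Hy : (Rabs y < eps / 2)%R) by exact HM.
  assert (Rmax (Rabs x) (Rabs y) < eps / 2)%R by (apply Rmax_lub_lt; auto).
  assert (sqrt 2 < 2)%R. { rewrite <- (sqrt_Rsqr 2) at 2 by lra. apply sqrt_lt_1; unfold Rsqr; lra. }
  assert (0 <= Rmax (Rabs x) (Rabs y))%R. { eapply Rle_trans; [apply (Rabs_pos x)|apply Rmax_l]. }
  eapply Rle_lt_trans; [apply Hm|].
  apply Rle_lt_trans with (2 * Rmax (Rabs x) (Rabs y))%R; [|lra].
  apply Rmult_le_compat_r; lra.
Qed.

(** * Finite sums, summable majorants and dominated convergence *)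

Fixpoint csum (f : nat -> C) (n : nat) : C :=
  match n with O => 0 | S m => csum f m + f m end.
Fixpoint rsum (f : nat -> R) (n : nat) : R :=
  match n with O => 0 | S m => (rsum f m + f m)%R end.

Definition summable (b : nat -> R) : Prop :=
  (forall n, (0 <= b n)%R) /\ exists M, forall n, (rsum b n <= M)%R.

Lemma rsum_le (f g : nat -> R) (n : nat) :
  (forall k, (k < n)%nat -> (f k <= g k)%R) -> (rsum f n <= rsum g n)%R.
Proof.
  induction n; intros H; simpl. lra.
  apply Rplus_le_compat; [apply IHn; intros; apply H; lia|apply H; lia].
Qed.

Lemma rsum_mono (b : nat -> R) (n m : nat) :
  (forall n, (0 <= b n)%R) -> (n <= m)%nat -> (rsum b n <= rsum b m)%R.
Proof. intros Hb H. induction H. lra. simpl. specialize (Hb m). lra. Qed.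

Lemma rsum_scal (b : nat -> R) (k : R) (n : nat) : rsum (fun i => k * b i)%R n = (k * rsum b n)%R.
Proof. induction n; simpl; [ring|rewrite IHn; ring]. Qed.

Lemma summable_le (a b : nat -> R) :
  (forall n, (0 <= a n <= b n)%R) -> summable b -> summable a.
Proof.
  intros H [Hb [M HM]]. split. apply H. exists M. intros n. eapply Rle_trans; [|apply (HM n)].
  apply rsum_le. intros; apply H.
Qed.

Lemma summable_scal (b : nat -> R) (k : R) : (0 <= k)%R -> summable b -> summable (fun n => k * b n)%R.
Proof.
  intros Hk [Hb [M HM]]. split. intros; apply Rmult_le_pos; auto.
  exists (k * M)%R. intros n. rewrite rsum_scal. apply Rmult_le_compat_l; auto.
Qed.

Lemma rsum_geom (r : R) (n : nat) : (0 <= r < 1)%R -> (rsum (fun j => r ^ j) n <= / (1 - r))%R.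
Proof.
  intros Hr.
  assert (E : (rsum (fun n => r ^ n) n * (1 - r) = 1 - r ^ n)%R).
  { induction n; simpl. ring. rewrite Rmult_plus_distr_r, IHn. ring. }
  apply Rmult_le_reg_r with (1 - r)%R. lra. rewrite E, Rinv_l by lra.
  assert (0 <= r ^ n)%R by (apply pow_le; lra). lra.
Qed.

Lemma summable_geom (r : R) : (0 <= r < 1)%R -> summable (fun n => r ^ n)%R.
Proof.
  intros Hr. split. intros; apply pow_le; lra.
  exists (/ (1 - r))%R. intros n. now apply rsum_geom.
Qed.

Lemma summable_tail (b : nat -> R) (eps : R) :
  summable b -> (eps > 0)%R -> exists K, forall n, (n >= K)%nat -> (rsum b n - rsum b K < eps)%R.
Proof.
  intros [Hb [M HM]] He.
  assert (Hg : Un_growing (rsum b)). { intros n. simpl. specialize (Hb n). lra. }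
  destruct (growing_cv (rsum b) Hg) as [l Hl]. { exists M. intros x [n ->]. apply HM. }
  destruct (Hl eps He) as [N HN]. exists N. intros n Hn.
  pose proof (growing_ineq _ _ Hg Hl n). specialize (HN N ltac:(lia)).
  unfold Rdist in HN. apply Rabs_def2 in HN. lra.
Qed.

Lemma csum_S (f : nat -> C) (n : nat) : csum f (S n) = csum f n + f n.
Proof. reflexivity. Qed.

Lemma csum_ext (f g : nat -> C) (n : nat) :
  (forall k, (k < n)%nat -> f k = g k) -> csum f n = csum g n.
Proof.
  induction n; intros H; simpl; auto. rewrite IHn, H; auto.
Qed.

Lemma csum_plus (f g : nat -> C) (n : nat) : csum (fun k => f k + g k) n = csum f n + csum g n.
Proof. induction n; simpl; [ring|rewrite IHn; ring]. Qed.

Lemma csum_scal (f : nat -> C) (k : C) (n : nat) : csum (fun i => k * f i) n = k * csum f n.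
Proof. induction n; simpl; [ring|rewrite IHn; ring]. Qed.

Lemma csum_swap (f : nat -> nat -> C) (n m : nat) :
  csum (fun i => csum (fun j => f i j) m) n = csum (fun j => csum (fun i => f i j) n) m.
Proof.
  induction n; simpl. induction m; simpl; [auto|rewrite <- IHm; ring].
  rewrite IHn, <- csum_plus. auto.
Qed.

Lemma csum_add (f : nat -> C) (n m : nat) :
  csum f (n + m) = csum f n + csum (fun k => f (n + k)%nat) m.
Proof. induction m; simpl. rewrite Nat.add_0_r. ring. rewrite Nat.add_succ_r. simpl. rewrite IHm. ring. Qed.

Lemma csum_first (f : nat -> C) (n : nat) : csum f (S n) = f O + csum (fun k => f (S k)) n.
Proof. change (S n) with (1 + n)%nat. rewrite csum_add. simpl. ring. Qed.

Lemma csum_rev (f : nat -> C) (n : nat) : csum (fun k => f (n - S k)%nat) n = csum f n.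
Proof.
  induction n; auto. rewrite csum_first. replace (S n - 1)%nat with n by lia.
  simpl. simpl in IHn. rewrite IHn. ring.
Qed.

Lemma Cmod_csum (f : nat -> C) (n : nat) : (Cmod (csum f n) <= rsum (fun k => Cmod (f k)) n)%R.
Proof.
  induction n; simpl. rewrite Cmod_0; lra. eapply Rle_trans; [apply Cmod_triangle|lra].
Qed.

Lemma Cmod_csum_tail (f : nat -> C) (b : nat -> R) (n m : nat) :
  (n <= m)%nat -> (forall k, (k < m)%nat -> (Cmod (f k) <= b k)%R) ->
  (Cmod (csum f m - csum f n) <= rsum b m - rsum b n)%R.
Proof.
  intros H Hf. induction H as [|m H IH]; simpl.
  - replace (csum f n - csum f n) with (Complex.RtoC 0) by ring. rewrite Cmod_0; lra.
  - replace (csum f m + f m - csum f n) with ((csum f m - csum f n) + f m) by ring.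
    eapply Rle_trans; [apply Cmod_triangle|].
    specialize (IH ltac:(intros; apply Hf; lia)). specialize (Hf m ltac:(lia)). lra.
Qed.

Lemma csum_cv (f : nat -> C) (b : nat -> R) :
  (forall k, (Cmod (f k) <= b k)%R) -> summable b -> exists l, cv (csum f) l.
Proof.
  intros Hf Hb. apply cv_Cauchy. intros eps He.
  destruct (summable_tail b (eps / 2) Hb ltac:(lra)) as [K HK].
  exists K. intros n m Hn Hm.
  pose proof (Cmod_csum_tail f b K n Hn ltac:(intros; apply Hf)).
  pose proof (Cmod_csum_tail f b K m Hm ltac:(intros; apply Hf)).
  pose proof (HK n Hn). pose proof (HK m Hm).
  pose proof (Cmod_sub_trans (csum f n) (csum f K) (csum f m)).
  rewrite (Cmod_minus_sym (csum f K) (csum f m)) in H3. lra.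
Qed.

Lemma csum_cv_pointwise (u : nat -> nat -> C) (v : nat -> C) (K : nat) :
  (forall k, cv (fun N => u N k) (v k)) -> cv (fun N => csum (u N) K) (csum v K).
Proof.
  intros H. induction K; simpl. apply cv_const. apply cv_plus; auto.
Qed.

(** Dominated convergence for sums whose length [phi N] grows with N, as happens for square partial
    sums and for the finite triple product. Beyond a fixed cutoff the majorant controls everything;
    pointwise convergence is used only below it. *)
Lemma tannery (u : nat -> nat -> C) (v : nat -> C) (b : nat -> R) (l : C) (phi : nat -> nat) :
  (forall N, (phi N >= N)%nat) ->
  (forall N k, (k < phi N)%nat -> (Cmod (u N k) <= b k)%R) -> summable b ->
  (forall k, cv (fun N => u N k) (v k)) -> cv (csum v) l -> cv (fun N => csum (u N) (phi N)) l.
Proof.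
  intros Hphi Hu Hb Hv Hl eps He.
  destruct (summable_tail b (eps / 4) Hb ltac:(lra)) as [K HK].
  destruct (Hl (eps / 4)%R ltac:(lra)) as [K' HK'].
  set (L := (K + K')%nat).
  destruct (csum_cv_pointwise u v L Hv (eps / 4)%R ltac:(lra)) as [N HN].
  exists (N + L)%nat. intros n Hn.
  specialize (HN n ltac:(lia)). specialize (HK' L ltac:(lia)).
  specialize (Hphi n).
  assert (A : (Cmod (csum (u n) (phi n) - csum (u n) L) <= rsum b (phi n) - rsum b L)%R).
  { apply Cmod_csum_tail. lia. intros; apply Hu; auto. }
  pose proof (HK (phi n) ltac:(lia)). pose proof (rsum_mono b K L (proj1 Hb) ltac:(lia)).
  pose proof (Cmod_sub_trans (csum (u n) (phi n)) (csum (u n) L) l).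
  pose proof (Cmod_sub_trans (csum (u n) L) (csum v L) l). lra.
Qed.

Lemma exp_le (x y : R) : (x <= y)%R -> (exp x <= exp y)%R.
Proof. intros [H|H]. left; now apply exp_increasing. right; now rewrite H. Qed.

(** * Sums over the integers *)

(** Pairing k with -1-k makes the first N pairs cover exactly the window -N, ..., N-1. Its even
    length fits both the parity splitting and the finite triple product without boundary terms. *)
Definition zpair (f : Z -> C) (k : nat) : C := f (Z.of_nat k) + f (- 1 - Z.of_nat k)%Z.

(* Junk value if the symmetric partial sums diverge; [edom] below guarantees absolute convergence. *)
Definition Zsum (f : Z -> C) : C :=
  epsilon (inhabits (0 : C)) (fun l => cv (csum (zpair f)) l).

(** The rate is fixed once and for all: Gaussian terms beat every exponential, and a shift of the
    index costs only a larger K. *)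
Definition edom (f : Z -> C) : Prop :=
  exists K : R, forall n : Z, (Cmod (f n) <= K * exp (- Rabs (IZR n)))%R.

Lemma summable_exp : summable (fun k => exp (- INR k)).
Proof.
  apply summable_le with (fun k => (exp (-1)) ^ k)%R.
  - intros n. split. left; apply exp_pos. right.
    induction n. simpl. rewrite Ropp_0, exp_0. auto.
    rewrite S_INR. replace (- (INR n + 1))%R with (- 1 + - INR n)%R by ring. rewrite exp_plus, IHn. auto.
  - apply summable_geom. split. left; apply exp_pos. rewrite <- exp_0. apply exp_increasing. lra.
Qed.

Lemma edom_nonneg (K : R) (f : Z -> C) :
  (forall n : Z, (Cmod (f n) <= K * exp (- Rabs (IZR n)))%R) -> (0 <= K)%R.
Proof.
  intros H. specialize (H 0%Z). rewrite Rabs_R0, Ropp_0, exp_0 in H. pose proof (Cmod_ge_0 (f 0%Z)). lra.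
Qed.

Lemma zpair_bound (f : Z -> C) (K : R) :
  (forall n : Z, (Cmod (f n) <= K * exp (- Rabs (IZR n)))%R) ->
  forall k, (Cmod (zpair f k) <= (2 * K) * exp (- INR k))%R.
Proof.
  intros H k. pose proof (edom_nonneg K f H) as HK. unfold zpair. eapply Rle_trans; [apply Cmod_triangle|].
  assert (H1 := H (Z.of_nat k)). assert (H2 := H (-1 - Z.of_nat k)%Z).
  rewrite <- INR_IZR_INZ in H1. rewrite minus_IZR, <- INR_IZR_INZ in H2.
  pose proof (pos_INR k).
  rewrite Rabs_pos_eq in H1 by auto.
  assert (exp (- Rabs (-1 - INR k)) <= exp (- INR k))%R.
  { apply exp_le. rewrite Rabs_left by lra. lra. }
  assert (K * exp (- Rabs (-1 - INR k)) <= K * exp (- INR k))%R by (apply Rmult_le_compat_l; auto).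
  lra.
Qed.

Lemma Zsum_cv (f : Z -> C) : edom f -> cv (csum (zpair f)) (Zsum f).
Proof.
  intros [K H]. unfold Zsum. apply epsilon_spec.
  apply csum_cv with (fun k => (2 * K) * exp (- INR k))%R. now apply zpair_bound.
  apply summable_scal. pose proof (edom_nonneg K f H); lra. apply summable_exp.
Qed.

Lemma Zsum_eq (f : Z -> C) (l : C) : cv (csum (zpair f)) l -> Zsum f = l.
Proof.
  intros H. apply cv_unique with (csum (zpair f)); auto.
  unfold Zsum. apply epsilon_spec. exists l; auto.
Qed.

Lemma Zsum_bound (f : Z -> C) (K : R) :
  (forall n : Z, (Cmod (f n) <= K * exp (- Rabs (IZR n)))%R) ->
  forall M, (forall n, (rsum (fun k => exp (- INR k)) n <= M)%R) -> (Cmod (Zsum f) <= 2 * K * M)%R.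
Proof.
  intros H M HM. apply cv_upper_bound with (csum (zpair f)); [|apply Zsum_cv; exists K; auto].
  intros n. eapply Rle_trans; [apply Cmod_csum|].
  eapply Rle_trans; [apply rsum_le; intros; apply zpair_bound with (K := K); auto|].
  rewrite rsum_scal. apply Rmult_le_compat_l; auto. pose proof (edom_nonneg K f H); lra.
Qed.

Lemma Zsum_ext (f g : Z -> C) : (forall n, f n = g n) -> Zsum f = Zsum g.
Proof.
  intros H. unfold Zsum. f_equal. apply functional_extensionality. intros l.
  replace f with g; auto. apply functional_extensionality. intros; rewrite H; auto.
Qed.

Lemma edom_le (f : Z -> C) (g : Z -> C) (B : R) :
  edom g -> (0 <= B)%R -> (forall n, (Cmod (f n) <= B * Cmod (g n))%R) -> edom f.
Proof.
  intros [K H] HB Hf. exists (B * K)%R. intros n. eapply Rle_trans; [apply Hf|].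
  rewrite Rmult_assoc. apply Rmult_le_compat_l; auto.
Qed.

Lemma edom_plus (f g : Z -> C) : edom f -> edom g -> edom (fun n => f n + g n).
Proof.
  intros [K H] [K' H']. exists (K + K')%R. intros n. eapply Rle_trans; [apply Cmod_triangle|].
  rewrite Rmult_plus_distr_r. apply Rplus_le_compat; auto.
Qed.

Lemma edom_scal (f : Z -> C) (k : C) : edom f -> edom (fun n => k * f n).
Proof.
  intros H. apply edom_le with f (Cmod k); auto. apply Cmod_ge_0. intros. rewrite Cmod_mult. lra.
Qed.

Lemma edom_comp (f : Z -> C) (phi : Z -> Z) (c : R) :
  (forall n, (Rabs (IZR n) <= Rabs (IZR (phi n)) + c)%R) -> edom f -> edom (fun n => f (phi n)).
Proof.
  intros Hphi [K H]. exists (K * exp c)%R. intros n. eapply Rle_trans; [apply H|].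
  rewrite Rmult_assoc. apply Rmult_le_compat_l. exact (edom_nonneg K f H).
  rewrite <- exp_plus. apply exp_le. specialize (Hphi n). lra.
Qed.

Lemma edom_shift (f : Z -> C) (k : Z) : edom f -> edom (fun n => f (n + k)%Z).
Proof.
  apply edom_comp with (Rabs (IZR k)). intros n. rewrite plus_IZR.
  replace (IZR n) with ((IZR n + IZR k) + - IZR k)%R at 1 by ring.
  eapply Rle_trans; [apply Rabs_triang|]. rewrite Rabs_Ropp. lra.
Qed.

Lemma edom_reflect (f : Z -> C) : edom f -> edom (fun n => f (- n)%Z).
Proof. apply edom_comp with 0%R. intros n. rewrite opp_IZR, Rabs_Ropp. lra. Qed.

Lemma Zsum_plus (f g : Z -> C) : edom f -> edom g -> Zsum (fun n => f n + g n) = Zsum f + Zsum g.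
Proof.
  intros Hf Hg. apply Zsum_eq.
  apply cv_ext with (fun n => csum (zpair f) n + csum (zpair g) n).
  - intros n. rewrite <- csum_plus. apply csum_ext. intros. unfold zpair. ring.
  - apply cv_plus; apply Zsum_cv; auto.
Qed.

Lemma Zsum_scal (f : Z -> C) (k : C) : edom f -> Zsum (fun n => k * f n) = k * Zsum f.
Proof.
  intros Hf. apply Zsum_eq. apply cv_ext with (fun n => k * csum (zpair f) n).
  - intros n. rewrite <- csum_scal. apply csum_ext. intros. unfold zpair. ring.
  - apply cv_scal; apply Zsum_cv; auto.
Qed.

Lemma Zsum_scal_r (f : Z -> C) (k : C) : edom f -> Zsum (fun n => f n * k) = Zsum f * k.
Proof.
  intros. rewrite Cmult_comm, <- Zsum_scal by auto. apply Zsum_ext. intros; ring.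
Qed.

Lemma edom_cv0 (f : Z -> C) (phi : nat -> Z) :
  edom f -> (forall n, (INR n <= Rabs (IZR (phi n)))%R) -> cv (fun n => f (phi n)) 0.
Proof.
  intros [K H] Hphi eps He. pose proof (edom_nonneg K f H) as HK.
  destruct (summable_tail _ (eps / (K + 1)) summable_exp) as [N HN].
  { apply Rdiv_lt_0_compat; lra. }
  exists N. intros n Hn. replace (f (phi n) - 0) with (f (phi n)) by ring.
  specialize (HN (S n) ltac:(lia)). simpl in HN.
  pose proof (rsum_mono (fun k => exp (- INR k)) N n (proj1 summable_exp) Hn).
  apply Rle_lt_trans with ((K + 1) * exp (- INR n))%R.
  - eapply Rle_trans; [apply H|]. pose proof (exp_pos (- INR n)).
    assert (exp (- Rabs (IZR (phi n))) <= exp (- INR n))%R by (apply exp_le; specialize (Hphi n); lra).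
    pose proof (exp_pos (- Rabs (IZR (phi n)))). nra.
  - replace eps with ((K + 1) * (eps / (K + 1)))%R by (field; lra).
    apply Rmult_lt_compat_l; lra.
Qed.

Lemma Zsum_succ (f : Z -> C) : edom f -> Zsum (fun n => f (n + 1)%Z) = Zsum f.
Proof.
  intros H. apply Zsum_eq.
  (* The windows -n..n-1 and -n+1..n differ by the two boundary terms f(n) and f(-n), which tend to
     0. *)
  apply cv_ext with (fun n => csum (zpair f) n + (f (Z.of_nat n) - f (- Z.of_nat n)%Z)).
  - induction n. simpl. ring. simpl csum. rewrite <- IHn. unfold zpair.
    rewrite Nat2Z.inj_succ. unfold Z.succ.
    replace (-1 - Z.of_nat n + 1)%Z with (- Z.of_nat n)%Z by lia.
    replace (- (Z.of_nat n + 1))%Z with (-1 - Z.of_nat n)%Z by lia. ring.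
  - replace (Zsum f) with (Zsum f + (0 - 0)) by ring. apply cv_plus. now apply Zsum_cv.
    apply cv_minus; apply edom_cv0; auto; intros n.
    + rewrite <- INR_IZR_INZ. apply Rle_abs.
    + rewrite opp_IZR, Rabs_Ropp, <- INR_IZR_INZ. apply Rle_abs.
Qed.

Lemma Zsum_shift (f : Z -> C) (k : Z) : edom f -> Zsum (fun n => f (n + k)%Z) = Zsum f.
Proof.
  intros H. induction k using Z.peano_ind.
  - apply Zsum_ext. intros; f_equal; lia.
  - rewrite <- IHk. rewrite <- (Zsum_succ (fun n => f (n + k)%Z)) by now apply edom_shift.
    apply Zsum_ext. intros; f_equal; lia.
  - rewrite <- IHk. rewrite <- (Zsum_succ (fun n => f (n + Z.pred k)%Z)) by now apply edom_shift.
    apply Zsum_ext. intros; f_equal; lia.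
Qed.

Lemma Zsum_reflect (f : Z -> C) : edom f -> Zsum (fun n => f (- n)%Z) = Zsum f.
Proof.
  (* The reflection preserving each pair is n -> -1-n, so the sum is first shifted by 1. *)
  intros H. rewrite <- (Zsum_shift (fun n => f (- n)%Z) 1) by now apply edom_reflect.
  apply Zsum_eq. apply cv_ext with (csum (zpair f)); [|now apply Zsum_cv].
  intros n. apply csum_ext. intros k _. unfold zpair. rewrite Cplus_comm. f_equal; f_equal; lia.
Qed.

Lemma edom_double (f : Z -> C) (j : Z) : edom f -> edom (fun n => f (2 * n + j)%Z).
Proof.
  intros H. apply (edom_comp (fun n => f (n + j)%Z) (fun n => (2 * n)%Z) 0).
  - intros n. rewrite mult_IZR, Rabs_mult. rewrite (Rabs_pos_eq 2) by lra. pose proof (Rabs_pos (IZR n)). lra.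
  - now apply edom_shift.
Qed.

(** Pairs 2k and 2k+1 of f consist of the same four terms as pair k of the even part and pair k of
    the odd part, so the partial sums agree exactly. *)
Lemma Zsum_even_odd (f : Z -> C) :
  edom f -> Zsum f = Zsum (fun n => f (2 * n)%Z) + Zsum (fun n => f (2 * n + 1)%Z).
Proof.
  intros H.
  assert (H0 : edom (fun n => f (2 * n)%Z)).
  { apply edom_comp with 0%R; auto. intros n. rewrite mult_IZR, Rabs_mult.
    rewrite (Rabs_pos_eq 2) by lra. pose proof (Rabs_pos (IZR n)). lra. }
  apply cv_unique with (fun n => csum (zpair f) (2 * n)).
  - apply (cv_subseq (csum (zpair f)) _ (fun n => (2 * n)%nat)). intros; lia. now apply Zsum_cv.
  - eapply cv_ext; [|apply cv_plus; apply Zsum_cv; [exact H0|now apply edom_double]].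
    intros n. cbv beta. induction n as [|n IH]. simpl; ring.
    replace (2 * S n)%nat with (S (S (2 * n))) by lia.
    rewrite !csum_S, <- IH. unfold zpair.
    replace (Z.of_nat (S (2 * n))) with (2 * Z.of_nat n + 1)%Z by lia.
    replace (Z.of_nat (2 * n)) with (2 * Z.of_nat n)%Z by lia.
    replace (2 * (-1 - Z.of_nat n))%Z with (-1 - (2 * Z.of_nat n + 1))%Z by lia.
    replace (-1 - (2 * Z.of_nat n + 1) + 1)%Z with (-1 - 2 * Z.of_nat n)%Z by lia. ring.
Qed.

(** * Double series over the integers *)

Definition edom2 (F : Z -> Z -> C) : Prop :=
  exists K : R, forall n m : Z, (Cmod (F n m) <= K * exp (- Rabs (IZR n)) * exp (- Rabs (IZR m)))%R.

Lemma edom2_swap (F : Z -> Z -> C) : edom2 F -> edom2 (fun n m => F m n).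
Proof. intros [K H]. exists K. intros n m. specialize (H m n). lra. Qed.

(** Square partial sums are symmetric in the two indices, so showing that they tend to one iterated
    sum gives the exchange of summations at once. [tannery] is applied to the outer sum, with inner
    sums still truncated at N. *)
Lemma Fubini_box (F : Z -> Z -> C) : edom2 F ->
  cv (fun N => csum (fun i => csum (fun j => zpair (fun n => zpair (F n) j) i) N) N)
     (Zsum (fun n => Zsum (F n))).
Proof.
  intros [K H]. destruct summable_exp as [_ [M HM]].
  assert (Hn : forall n, edom (F n)). { intros n. exists (K * exp (- Rabs (IZR n)))%R. apply H. }
  assert (Hout : edom (fun n => Zsum (F n))).
  { exists (2 * K * M)%R. intros n. eapply Rle_trans; [apply (Zsum_bound (F n) (K * exp (- Rabs (IZR n))))|]; auto. lra. }
  assert (HK : (0 <= K)%R).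
  { specialize (H 0%Z 0%Z). rewrite Rabs_R0, Ropp_0, exp_0 in H. pose proof (Cmod_ge_0 (F 0%Z 0%Z)). lra. }
  assert (HM0 : (0 <= M)%R). { apply (HM O). }
  apply (tannery (fun N i => csum (fun j => zpair (fun n => zpair (F n) j) i) N)
           (zpair (fun n => Zsum (F n))) (fun i => (2 * (2 * K * M)) * exp (- INR i))%R _ (fun N => N)).
  - auto.
  - intros N i _.
    replace (csum (fun j => zpair (fun n => zpair (F n) j) i) N)
      with (zpair (fun n => csum (zpair (F n)) N) i).
    2:{ unfold zpair at 1. rewrite <- csum_plus. apply csum_ext. intros; reflexivity. }
    apply zpair_bound. intros n. eapply Rle_trans; [apply Cmod_csum|].
    eapply Rle_trans; [apply rsum_le; intros; apply (zpair_bound (F n) (K * exp (- Rabs (IZR n)))); auto|].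
    rewrite rsum_scal. replace (2 * K * M * exp (- Rabs (IZR n)))%R with (2 * (K * exp (- Rabs (IZR n))) * M)%R by ring.
    apply Rmult_le_compat_l; auto. pose proof (exp_pos (- Rabs (IZR n))). nra.
  - apply summable_scal; [|apply summable_exp]. nra.
  - intros i. unfold zpair at 3.
    apply cv_ext with (fun N => csum (zpair (F (Z.of_nat i))) N + csum (zpair (F (-1 - Z.of_nat i)%Z)) N).
    + intros N. rewrite <- csum_plus. apply csum_ext. intros; reflexivity.
    + apply cv_plus; apply Zsum_cv; auto.
  - now apply Zsum_cv.
Qed.

Lemma Zsum_Fubini (F : Z -> Z -> C) : edom2 F ->
  Zsum (fun n => Zsum (F n)) = Zsum (fun m => Zsum (fun n => F n m)).
Proof.
  intros H. eapply cv_unique. apply Fubini_box; auto.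
  eapply cv_ext; [|apply (Fubini_box (fun m n => F n m)); now apply edom2_swap].
  intros N. simpl. rewrite csum_swap. apply csum_ext. intros. apply csum_ext. intros.
  unfold zpair. ring.
Qed.

(** * The complex exponential *)

Definition cexp (z : C) : C := Cexp z.

Lemma Cexp_plus (z w : C) : cexp (z + w) = cexp z * cexp w.
Proof.
  unfold cexp, Cexp. apply injective_projections; simpl; rewrite exp_plus, ?cos_plus, ?sin_plus; ring.
Qed.

Lemma Cexp_0 : cexp (0 : C) = 1.
Proof. unfold cexp, Cexp. simpl. rewrite exp_0, cos_0, sin_0. apply injective_projections; simpl; ring. Qed.

Lemma Cmod_Cexp (z : C) : Cmod (cexp z) = exp (fst z).
Proof.
  unfold Cmod, cexp. simpl fst; simpl snd.
  replace ((exp (fst z) * cos (snd z)) ^ 2 + (exp (fst z) * sin (snd z)) ^ 2)%R with (exp (fst z) * exp (fst z))%R.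
  - apply sqrt_square. left; apply exp_pos.
  - pose proof (sin2_cos2 (snd z)). unfold Rsqr in H.
    replace ((exp (fst z) * cos (snd z)) ^ 2 + (exp (fst z) * sin (snd z)) ^ 2)%R
      with (exp (fst z) * exp (fst z) * (sin (snd z) * sin (snd z) + cos (snd z) * cos (snd z)))%R by ring.
    rewrite H. ring.
Qed.

Lemma Cexp_neq_0 (z : C) : cexp z <> (0 : C).
Proof. apply Cmod_gt_0. rewrite Cmod_Cexp. apply exp_pos. Qed.

Lemma Cexp_opp (z : C) : cexp (- z) = / cexp z.
Proof.
  assert (H : cexp (- z) * cexp z = 1).
  { rewrite <- Cexp_plus. replace (- z + z) with (0 : C) by ring. apply Cexp_0. }
  replace (cexp (- z)) with (cexp (- z) * cexp z * / cexp z) by (field; apply Cexp_neq_0).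
  rewrite H. ring.
Qed.

Definition iPI : C := (0%R, PI).

Lemma Cexp_iPI : cexp iPI = - (1 : C).
Proof.
  unfold cexp, Cexp, iPI. simpl. rewrite exp_0, cos_PI, sin_PI. apply injective_projections; simpl; ring.
Qed.

Lemma Cexp_iPI_even (n : Z) : cexp (2 * IZR n * iPI) = 1.
Proof.
  assert (H2 : cexp (2 * iPI) = 1).
  { replace (2 * iPI) with (iPI + iPI) by ring. rewrite Cexp_plus, Cexp_iPI. ring. }
  induction n using Z.peano_ind.
  - rewrite <- Cexp_0. f_equal. ring.
  - unfold Z.succ. rewrite plus_IZR, RtoC_plus.
    replace (2 * (IZR n + 1) * iPI) with (2 * IZR n * iPI + 2 * iPI) by ring.
    rewrite Cexp_plus, IHn, H2. ring.
  - unfold Z.pred. rewrite plus_IZR, RtoC_plus.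
    replace (2 * (IZR n + IZR (-1)) * iPI) with (2 * IZR n * iPI + - (2 * iPI)) by ring.
    rewrite Cexp_plus, IHn, Cexp_opp, H2. field.
Qed.

Lemma Cmod_le_components (x y M : R) : (Rabs x <= M)%R -> (Rabs y <= M)%R -> (Cmod (x, y) <= 2 * M)%R.
Proof.
  intros Hx Hy. eapply Rle_trans; [apply Cmod_2Rmax|]. simpl.
  assert (sqrt 2 <= 2)%R. { rewrite <- (sqrt_Rsqr 2) at 2 by lra. apply sqrt_le_1; unfold Rsqr; lra. }
  assert (Rmax (Rabs x) (Rabs y) <= M)%R by (apply Rmax_lub; auto).
  pose proof (Rabs_pos x). pose proof (Rmax_l (Rabs x) (Rabs y)). pose proof (sqrt_pos 2). nra.
Qed.

(** A mean value inequality for a complex function of a real variable: the real theorem is applied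
    to each component, and recombining them costs the factor 2. *)
Lemma Cmod_MVT (g1 g2 d1 d2 : R -> R) (M : R) :
  (forall t, (0 <= t <= 1)%R -> is_derive g1 t (d1 t)) ->
  (forall t, (0 <= t <= 1)%R -> is_derive g2 t (d2 t)) ->
  (forall t, (0 <= t <= 1)%R -> (Cmod (d1 t, d2 t) <= M)%R) ->
  forall x, (0 <= x <= 1)%R -> (Cmod (g1 x - g1 0, g2 x - g2 0)%R <= 2 * M)%R.
Proof.
  intros H1 H2 HM x Hx.
  assert (Hg : forall g d : R -> R, (forall t, (0 <= t <= 1)%R -> is_derive g t (d t)) ->
    (forall t, (0 <= t <= 1)%R -> (Rabs (d t) <= M)%R) -> (Rabs (g x - g 0) <= M)%R).
  { intros g d Hd Hb. destruct (MVT_gen g 0 x d) as [c [Hc E]].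
    - intros t Ht. rewrite Rmin_left, Rmax_right in Ht by lra. apply Hd; lra.
    - intros t Ht. rewrite Rmin_left, Rmax_right in Ht by lra.
      apply continuity_pt_filterlim. apply (ex_derive_continuous g t). exists (d t). apply Hd; lra.
    - rewrite Rmin_left, Rmax_right in Hc by lra. rewrite E, Rabs_mult.
      replace M with (M * 1)%R by ring. apply Rmult_le_compat; try apply Rabs_pos.
      apply Hb; lra. rewrite Rabs_pos_eq; lra. }
  pose proof Cmod_components as Hc.
  apply Cmod_le_components.
  - apply (Hg g1 d1); auto. intros t Ht. eapply Rle_trans; [|apply (HM t Ht)]. apply (Hc (d1 t, d2 t)).
  - apply (Hg g2 d2); auto. intros t Ht. eapply Rle_trans; [|apply (HM t Ht)]. apply (Hc (d1 t, d2 t)).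
Qed.

(** Along t -> tw, the derivative of each Taylor remainder of the exponential is w times the
    preceding remainder. Three uses of [Cmod_MVT] give Cmod w ^ 3, and their factors 2 give the
    8. *)
Lemma Cexp_taylor2 (w : C) :
  (Cmod (cexp w - 1 - w - w * w / 2) <= 8 * Cmod w ^ 3 * exp (Cmod w))%R.
Proof.
  set (m := Cmod w). assert (Hm : (0 <= m)%R) by apply Cmod_ge_0.
  set (a := fst w). set (b := snd w). assert (Ew : w = (a, b)) by (unfold a, b; now destruct w).
  assert (Ha : (a <= m)%R).
  { pose proof (Rmax_Cmod w) as H. pose proof (Rmax_l (Rabs (fst w)) (Rabs (snd w))) as H'.
    fold m in H. fold a in H, H'. pose proof (Rle_abs a). lra. }
  clearbody a b.
  assert (E0 : forall t, (0 <= t <= 1)%R ->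
    (Cmod (exp (t * a) * cos (t * b) - 1, exp (t * a) * sin (t * b))%R <= 2 * (m * exp m))%R).
  { intros t Ht.
    unshelve epose proof (Cmod_MVT (fun t => exp (t * a) * cos (t * b))%R (fun t => exp (t * a) * sin (t * b))%R
       (fun t => exp (t * a) * (a * cos (t * b) - b * sin (t * b)))%R
       (fun t => exp (t * a) * (a * sin (t * b) + b * cos (t * b)))%R (m * exp m)%R _ _ _ t Ht) as H.
    - intros; auto_derive; auto; ring.
    - intros; auto_derive; auto; ring.
    - intros s Hs. cbv beta. match goal with |- (Cmod ?z <= _)%R => replace z with (w * cexp ((s * a)%R, (s * b)%R)) end.
      2:{ rewrite Ew. unfold cexp, Cexp. apply injective_projections; simpl; ring. }
      rewrite Cmod_mult, Cmod_Cexp. fold m. apply Rmult_le_compat_l; auto. apply exp_le. simpl. nra.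
    - cbv beta in H. match type of H with (Cmod ?z <= _)%R => match goal with |- (Cmod ?z' <= _)%R => replace z' with z; [exact H|] end end.
      cbv beta. rewrite !Rmult_0_l, exp_0, cos_0, sin_0. apply injective_projections; simpl; ring. }
  assert (E1 : forall t, (0 <= t <= 1)%R ->
    (Cmod (exp (t * a) * cos (t * b) - 1 - t * a, exp (t * a) * sin (t * b) - t * b)%R <= 2 * (m * (2 * (m * exp m))))%R).
  { intros t Ht.
    unshelve epose proof (Cmod_MVT (fun t => exp (t * a) * cos (t * b) - 1 - t * a)%R (fun t => exp (t * a) * sin (t * b) - t * b)%R
       (fun t => exp (t * a) * (a * cos (t * b) - b * sin (t * b)) - a)%R
       (fun t => exp (t * a) * (a * sin (t * b) + b * cos (t * b)) - b)%R (m * (2 * (m * exp m)))%R _ _ _ t Ht) as H.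
    - intros; auto_derive; auto; ring.
    - intros; auto_derive; auto; ring.
    - intros s Hs. cbv beta. match goal with |- (Cmod ?z <= _)%R => replace z
        with (w * ((exp (s * a) * cos (s * b) - 1)%R, (exp (s * a) * sin (s * b))%R)) end.
      2:{ rewrite Ew. apply injective_projections; simpl; ring. }
      rewrite Cmod_mult. fold m. apply Rmult_le_compat_l; auto.
    - cbv beta in H. match type of H with (Cmod ?z <= _)%R => match goal with |- (Cmod ?z' <= _)%R => replace z' with z; [exact H|] end end.
      cbv beta. rewrite !Rmult_0_l, exp_0, cos_0, sin_0. apply injective_projections; simpl; ring. }
  unshelve epose proof (Cmod_MVT (fun t => exp (t * a) * cos (t * b) - 1 - t * a - t * t * (a * a - b * b) / 2)%R
       (fun t => exp (t * a) * sin (t * b) - t * b - t * t * (a * b))%R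
       (fun t => exp (t * a) * (a * cos (t * b) - b * sin (t * b)) - a - t * (a * a - b * b))%R
       (fun t => exp (t * a) * (a * sin (t * b) + b * cos (t * b)) - b - 2 * t * (a * b))%R
       (m * (2 * (m * (2 * (m * exp m)))))%R _ _ _ 1%R _) as H; [| | |lra|].
  - intros; auto_derive; auto; field.
  - intros; auto_derive; auto; ring.
  - intros s Hs. cbv beta. match goal with |- (Cmod ?z <= _)%R => replace z with
      (w * ((exp (s * a) * cos (s * b) - 1 - s * a)%R, (exp (s * a) * sin (s * b) - s * b)%R)) end.
    2:{ rewrite Ew. apply injective_projections; simpl; ring. }
    rewrite Cmod_mult. fold m. apply Rmult_le_compat_l; auto.
  - cbv beta in H. match type of H with (Cmod ?z <= _)%R => replace (cexp w - 1 - w - w * w / 2) with z end.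
    + eapply Rle_trans; [apply H|]. right. ring.
    + rewrite Ew. unfold cexp, Cexp. cbv beta. rewrite !Rmult_0_l, exp_0, cos_0, sin_0, !Rmult_1_l.
      apply injective_projections; simpl; field.
Qed.

Lemma gauss_bound (A B a : R) : (A < 0)%R ->
  exists K, (0 <= K)%R /\ forall x, (exp (A * (x * x) + B * x) <= K * exp (- (a * Rabs x)))%R.
Proof.
  (* Completing the square: A y^2 + c y is at most c^2 / (-4A), with y = |x| and c = |B| + a. *)
  intros HA. exists (exp ((Rabs B + a) ^ 2 / (- 4 * A))). split. left; apply exp_pos.
  intros x. rewrite <- exp_plus. apply exp_le.
  assert (B * x <= Rabs B * Rabs x)%R by (rewrite <- Rabs_mult; apply Rle_abs).
  assert (x * x = Rabs x * Rabs x)%R by (rewrite <- Rabs_mult; symmetry; apply Rabs_pos_eq; nra).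
  rewrite H0. set (y := Rabs x) in *. set (c := (Rabs B + a)%R) in *.
  assert (A * (y * y) + c * y <= c ^ 2 / (- 4 * A))%R.
  { apply Rmult_le_reg_r with (- 4 * A)%R. lra.
    replace (c ^ 2 / (-4 * A) * (-4 * A))%R with (c ^ 2)%R by (field; lra).
    pose proof (Rle_0_sqr (2 * A * y + c)). unfold Rsqr in H1. nra. }
  unfold c in *. nra.
Qed.

(** * Gaussian sums *)

Definition gterm (A B : C) (n : Z) : C := cexp (A * (IZR n * IZR n) + B * IZR n).
Definition gs (A B : C) : C := Zsum (gterm A B).

Lemma Cmod_gterm (A B : C) (n : Z) :
  Cmod (gterm A B n) = exp (fst A * (IZR n * IZR n) + fst B * IZR n).
Proof. unfold gterm. rewrite Cmod_Cexp. f_equal. simpl. ring. Qed.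

Lemma gterm_bound (A B : C) (a : R) : (fst A < 0)%R ->
  exists K, (0 <= K)%R /\ forall n, (Cmod (gterm A B n) <= K * exp (- (a * Rabs (IZR n))))%R.
Proof.
  intros HA. destruct (gauss_bound (fst A) (fst B) a HA) as [K [HK H]].
  exists K. split; auto. intros n. rewrite Cmod_gterm. apply H.
Qed.

Lemma gterm_edom (A B : C) : (fst A < 0)%R -> edom (gterm A B).
Proof.
  intros HA. destruct (gterm_bound A B 1 HA) as [K [HK H]]. exists K. intros n.
  rewrite <- (Rmult_1_l (Rabs (IZR n))). auto.
Qed.

Lemma gs_reflect (A B : C) : (fst A < 0)%R -> gs A (- B) = gs A B.
Proof.
  intros HA. unfold gs. rewrite <- (Zsum_reflect (gterm A B)) by now apply gterm_edom.
  apply Zsum_ext. intros n. unfold gterm. rewrite opp_IZR, RtoC_opp. f_equal. ring.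
Qed.

(** Quasi-periodicity: A n^2 + (B + 2A) n = A (n+1)^2 + B (n+1) - A - B. *)
Lemma gs_shift (A B : C) : (fst A < 0)%R -> gs A (B + 2 * A) = cexp (- A - B) * gs A B.
Proof.
  intros HA. unfold gs. rewrite <- (Zsum_shift (gterm A B) 1) by now apply gterm_edom.
  rewrite <- Zsum_scal by (apply edom_shift; now apply gterm_edom).
  apply Zsum_ext. intros n. unfold gterm. rewrite <- Cexp_plus, plus_IZR, RtoC_plus. f_equal. ring.
Qed.

Lemma gs_period (A B : C) : gs A (B + 2 * iPI) = gs A B.
Proof.
  apply Zsum_ext. intros n. unfold gterm.
  replace (A * (IZR n * IZR n) + (B + 2 * iPI) * IZR n)
    with (A * (IZR n * IZR n) + B * IZR n + 2 * IZR n * iPI) by ring.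
  rewrite Cexp_plus, Cexp_iPI_even. ring.
Qed.

(* Splitting the lattice points (n, m) by the parity of n + m. *)
Lemma gs_mult (A u v : C) : (fst A < 0)%R ->
  gs A u * gs A v =
  gs (2 * A) (u + v) * gs (2 * A) (u - v)
  + cexp (A + v) * (gs (2 * A) (u + v + 2 * A) * gs (2 * A) (u - v - 2 * A)).
Proof.
  intros HA.
  assert (H2A : (fst (2 * A)%C < 0)%R) by (simpl; lra).
  (* Here m is the total index. Recentring n at k for m = 2k gives n^2 + (m-n)^2 -> 2n^2 + 2k^2; for
     m = 2k+1 the form becomes 2n^2 + 2k^2 + 2(k-n) + 1, whence the shifts by 2A and the prefactor
     of the odd part. *)
  set (F := fun n m : Z => gterm A u n * gterm A v (m - n)%Z).
  assert (HF : edom2 F).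
  (* Rate 2 is what makes the sheared terms summable in both indices: 2|n| + 2|m-n| is at least |n|
     + |m|. *)
  { destruct (gterm_bound A u 2 HA) as [K [HK H]]. destruct (gterm_bound A v 2 HA) as [K' [HK' H']].
    exists (K * K')%R. intros n m. unfold F. rewrite Cmod_mult.
    eapply Rle_trans; [apply Rmult_le_compat; try apply Cmod_ge_0; [apply H|apply H']|].
    replace (K * exp (- (2 * Rabs (IZR n))) * (K' * exp (- (2 * Rabs (IZR (m - n))))))%R
      with (K * K' * (exp (- (2 * Rabs (IZR n))) * exp (- (2 * Rabs (IZR (m - n))))))%R by ring.
    rewrite (Rmult_assoc (K * K')). apply Rmult_le_compat_l. now apply Rmult_le_pos.
    rewrite <- !exp_plus. apply exp_le. rewrite minus_IZR.
    pose proof (Rabs_triang (IZR n) (IZR m - IZR n)).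
    replace (IZR n + (IZR m - IZR n))%R with (IZR m) in H0 by ring.
    pose proof (Rabs_pos (IZR m - IZR n)). lra. }
  assert (E : gs A u * gs A v = Zsum (fun n => Zsum (F n))).
  { unfold gs. rewrite <- Zsum_scal_r by now apply gterm_edom. apply Zsum_ext. intros n.
    unfold F. rewrite Zsum_scal by (apply (edom_shift (gterm A v) (- n)%Z); now apply gterm_edom).
    f_equal. symmetry. apply (Zsum_shift (gterm A v) (- n)%Z). now apply gterm_edom. }
  rewrite E, Zsum_Fubini by auto.
  assert (HFm : forall m, edom (fun n => F n m)).
  { intros m. destruct HF as [K HF]. exists (K * exp (- Rabs (IZR m)))%R. intros n. specialize (HF n m). lra. }
  assert (Hout : edom (fun m => Zsum (fun n => F n m))).
  { destruct HF as [K HF]. destruct summable_exp as [_ [M HM]]. exists (2 * K * M)%R. intros m.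
    eapply Rle_trans; [apply (Zsum_bound (fun n => F n m) (K * exp (- Rabs (IZR m))))|]; auto.
    intros n. specialize (HF n m). lra. lra. }
  rewrite Zsum_even_odd by auto. f_equal.
  - unfold gs. rewrite <- Zsum_scal_r by now apply gterm_edom. apply Zsum_ext. intros k.
    rewrite <- (Zsum_shift (fun n => F n (2 * k)%Z) k) by auto.
    rewrite <- Zsum_scal by now apply gterm_edom. apply Zsum_ext. intros n.
    unfold F, gterm. rewrite <- !Cexp_plus. f_equal.
    replace (2 * k - (n + k))%Z with (k - n)%Z by ring.
    rewrite minus_IZR, plus_IZR, RtoC_plus, RtoC_minus. ring.
  - unfold gs. rewrite Cmult_assoc, <- (Zsum_scal _ (cexp (A + v))), <- Zsum_scal_r;
      [|apply edom_scal; now apply gterm_edom|now apply gterm_edom].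
    apply Zsum_ext. intros k.
    rewrite <- (Zsum_shift (fun n => F n (2 * k + 1)%Z) k) by auto.
    rewrite <- Zsum_scal by now apply gterm_edom. apply Zsum_ext. intros n.
    unfold F, gterm. rewrite <- !Cexp_plus. f_equal.
    replace (2 * k + 1 - (n + k))%Z with (k - n + 1)%Z by ring.
    rewrite !plus_IZR, minus_IZR, !RtoC_plus, RtoC_minus. ring.
Qed.

(** * Second-order expansions at 0 *)

Definition locb (f : C -> C) : Prop :=
  exists d K : R, (0 < d)%R /\ (0 <= K)%R /\ forall h, (Cmod h < d)%R -> (Cmod (f h) <= K)%R.
Definition bigO3 (f : C -> C) : Prop :=
  exists d K : R, (0 < d)%R /\ (0 <= K)%R /\ forall h, (Cmod h < d)%R -> (Cmod (f h) <= K * Cmod h ^ 3)%R.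
(** Taylor coefficients, not derivatives: [a2] is half the second derivative. A remainder O(h^3) at
    the single point 0 is all that is asked, and this is stable under the algebra that follows. *)
Definition tay (f : C -> C) (a0 a1 a2 : C) : Prop :=
  bigO3 (fun h => f h - (a0 + a1 * h + a2 * (h * h))).

Lemma locb_ext (f g : C -> C) : (forall h, f h = g h) -> locb f -> locb g.
Proof. intros E (d & K & Hd & HK & H). exists d, K. repeat split; auto. intros; rewrite <- E; auto. Qed.

Lemma bigO3_ext (f g : C -> C) : (forall h, f h = g h) -> bigO3 f -> bigO3 g.
Proof. intros E (d & K & Hd & HK & H). exists d, K. repeat split; auto. intros; rewrite <- E; auto. Qed.

Lemma tay_ext (f g : C -> C) (a0 a1 a2 : C) : (forall h, f h = g h) -> tay f a0 a1 a2 -> tay g a0 a1 a2.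
Proof. intros E. apply bigO3_ext. intros; rewrite E; auto. Qed.

Lemma locb_const (a : C) : locb (fun _ => a).
Proof. exists 1%R, (Cmod a). repeat split; try lra. apply Cmod_ge_0. intros; lra. Qed.

Lemma locb_id : locb (fun h => h).
Proof. exists 1%R, 1%R. repeat split; try lra. intros; lra. Qed.

Lemma locb_plus (f g : C -> C) : locb f -> locb g -> locb (fun h => f h + g h).
Proof.
  intros (d & K & Hd & HK & H) (d' & K' & Hd' & HK' & H'). exists (Rmin d d'), (K + K')%R.
  split; [apply Rmin_glb_lt; auto|split; [lra|]]. intros h Hh.
  pose proof (Rmin_l d d'). pose proof (Rmin_r d d').
  eapply Rle_trans; [apply Cmod_triangle|]. apply Rplus_le_compat; [apply H|apply H']; lra.
Qed.

Lemma locb_mult (f g : C -> C) : locb f -> locb g -> locb (fun h => f h * g h).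
Proof.
  intros (d & K & Hd & HK & H) (d' & K' & Hd' & HK' & H'). exists (Rmin d d'), (K * K')%R.
  split; [apply Rmin_glb_lt; auto|split; [now apply Rmult_le_pos|]]. intros h Hh.
  pose proof (Rmin_l d d'). pose proof (Rmin_r d d').
  rewrite Cmod_mult. apply Rmult_le_compat; try apply Cmod_ge_0; [apply H|apply H']; lra.
Qed.

Lemma locb_poly (a0 a1 a2 : C) : locb (fun h => a0 + a1 * h + a2 * (h * h)).
Proof. repeat (apply locb_plus || apply locb_mult || apply locb_const || apply locb_id). Qed.

Lemma bigO3_plus (f g : C -> C) : bigO3 f -> bigO3 g -> bigO3 (fun h => f h + g h).
Proof.
  intros (d & K & Hd & HK & H) (d' & K' & Hd' & HK' & H'). exists (Rmin d d'), (K + K')%R.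
  split; [apply Rmin_glb_lt; auto|split; [lra|]]. intros h Hh.
  pose proof (Rmin_l d d'). pose proof (Rmin_r d d').
  eapply Rle_trans; [apply Cmod_triangle|]. rewrite Rmult_plus_distr_r.
  apply Rplus_le_compat; [apply H|apply H']; lra.
Qed.

Lemma bigO3_mult (f g : C -> C) : locb f -> bigO3 g -> bigO3 (fun h => f h * g h).
Proof.
  intros (d & K & Hd & HK & H) (d' & K' & Hd' & HK' & H'). exists (Rmin d d'), (K * K')%R.
  split; [apply Rmin_glb_lt; auto|split; [now apply Rmult_le_pos|]]. intros h Hh.
  pose proof (Rmin_l d d'). pose proof (Rmin_r d d').
  rewrite Cmod_mult, Rmult_assoc. apply Rmult_le_compat; try apply Cmod_ge_0; [apply H|apply H']; lra.
Qed.

Lemma bigO3_cube : bigO3 (fun h => h * h * h).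
Proof. exists 1%R, 1%R. repeat split; try lra. intros. rewrite !Cmod_mult. lra. Qed.

Lemma bigO3_locb (f : C -> C) : bigO3 f -> locb f.
Proof.
  intros (d & K & Hd & HK & H). exists (Rmin d 1), K.
  split; [apply Rmin_glb_lt; lra|split; auto]. intros h Hh.
  pose proof (Rmin_l d 1). pose proof (Rmin_r d 1). eapply Rle_trans; [apply H; lra|].
  assert (Cmod h ^ 3 <= 1)%R. { replace 1%R with (1 ^ 3)%R by ring. apply pow_incr. split. apply Cmod_ge_0. lra. }
  nra.
Qed.

Lemma tay_locb (f : C -> C) (a0 a1 a2 : C) : tay f a0 a1 a2 -> locb f.
Proof.
  intros H. apply bigO3_locb in H.
  eapply locb_ext; [|apply locb_plus; [exact H|apply (locb_poly a0 a1 a2)]]. intros h. simpl. ring.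
Qed.

Lemma tay_poly (a0 a1 a2 : C) : tay (fun h => a0 + a1 * h + a2 * (h * h)) a0 a1 a2.
Proof.
  exists 1%R, 0%R. repeat split; try lra. intros.
  match goal with |- (Cmod ?z <= _)%R => replace z with (0 : C) by ring end. rewrite Cmod_0. lra.
Qed.

Lemma tay_const (a : C) : tay (fun _ => a) a 0 0.
Proof. eapply tay_ext; [|apply tay_poly]. intros; simpl; ring. Qed.

Lemma tay_eq (f : C -> C) (a0 a1 a2 b0 b1 b2 : C) :
  tay f a0 a1 a2 -> a0 = b0 -> a1 = b1 -> a2 = b2 -> tay f b0 b1 b2.
Proof. intros; subst; auto. Qed.

Lemma tay_plus (f g : C -> C) (a0 a1 a2 b0 b1 b2 : C) :
  tay f a0 a1 a2 -> tay g b0 b1 b2 -> tay (fun h => f h + g h) (a0 + b0) (a1 + b1) (a2 + b2).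
Proof.
  intros Hf Hg. eapply bigO3_ext; [|apply (bigO3_plus _ _ Hf Hg)]. intros; simpl; ring.
Qed.

Lemma tay_mult (f g : C -> C) (a0 a1 a2 b0 b1 b2 : C) :
  tay f a0 a1 a2 -> tay g b0 b1 b2 ->
  tay (fun h => f h * g h) (a0 * b0) (a0 * b1 + a1 * b0) (a0 * b2 + a1 * b1 + a2 * b0).
Proof.
  intros Hf Hg. pose proof (tay_locb _ _ _ _ Hf) as Bf.
  (* With polynomial parts Pf and Pg the remainder is f (g - Pg) + Pg (f - Pf) plus the terms of
     degree 3 and 4 of Pf Pg. *)
  eapply bigO3_ext; [|apply (bigO3_plus _ _ (bigO3_mult _ _ Bf Hg)
    (bigO3_plus _ _ (bigO3_mult _ _ (locb_poly b0 b1 b2) Hf)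
       (bigO3_mult _ _ (locb_poly (a1 * b2 + a2 * b1) (a2 * b2) 0) bigO3_cube)))].
  intros; simpl; ring.
Qed.

Lemma tay_scal (f : C -> C) (k a0 a1 a2 : C) :
  tay f a0 a1 a2 -> tay (fun h => k * f h) (k * a0) (k * a1) (k * a2).
Proof. intros H. eapply tay_eq. apply tay_mult. apply (tay_const k). apply H. all: ring. Qed.

Lemma tay_dilate (f : C -> C) (k a0 a1 a2 : C) :
  tay f a0 a1 a2 -> tay (fun h => f (k * h)) a0 (k * a1) (k * k * a2).
Proof.
  intros (d & K & Hd & HK & H). set (c := Cmod k). assert (0 <= c)%R by apply Cmod_ge_0.
  exists (d / (c + 1))%R, (K * c ^ 3)%R. split; [apply Rdiv_lt_0_compat; lra|split].
  - apply Rmult_le_pos; auto. now apply pow_le.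
  - intros h Hh. specialize (H (k * h)).
    replace (f (k * h) - (a0 + k * a1 * h + k * k * a2 * (h * h)))
      with (f (k * h) - (a0 + a1 * (k * h) + a2 * (k * h * (k * h)))) by ring.
    rewrite Cmod_mult in H. fold c in H. rewrite Rpow_mult_distr in H.
    rewrite Rmult_assoc. apply H. pose proof (Cmod_ge_0 h).
    apply Rle_lt_trans with ((c + 1) * Cmod h)%R. nra.
    replace d with ((c + 1) * (d / (c + 1)))%R at 1 by (field; lra). apply Rmult_lt_compat_l; lra.
Qed.

Lemma C_zero_of_small (c : C) (d K : R) :
  (0 < d)%R -> (forall t : R, (0 < t < d)%R -> (Cmod c <= K * t)%R) -> c = 0.
Proof.
  intros Hd H. apply Cmod_eq_0. pose proof (Cmod_ge_0 c).
  destruct (Req_dec (Cmod c) 0) as [|E]; auto. exfalso.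
  set (t := Rmin (d / 2) (Cmod c / (2 * (Rabs K + 1)))).
  assert (HK := Rabs_pos K).
  assert (Ht : (0 < t)%R). { apply Rmin_glb_lt. lra. apply Rdiv_lt_0_compat; lra. }
  assert (t <= d / 2)%R by apply Rmin_l. assert (t <= Cmod c / (2 * (Rabs K + 1)))%R by apply Rmin_r.
  specialize (H t ltac:(lra)).
  assert (K * t <= (Rabs K + 1) * t)%R. { apply Rmult_le_compat_r. lra. pose proof (Rle_abs K). lra. }
  assert ((Rabs K + 1) * t <= Cmod c / 2)%R.
  { replace (Cmod c / 2)%R with ((Rabs K + 1) * (Cmod c / (2 * (Rabs K + 1))))%R by (field; lra).
    apply Rmult_le_compat_l; lra. }
  lra.
Qed.

Lemma Cmod_t (t : R) : (0 < t)%R -> Cmod t = t.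
Proof. intros. rewrite Cmod_R. apply Rabs_pos_eq. lra. Qed.

(** Testing on small positive real h suffices: the coefficients of the difference are removed one at
    a time, dividing by t at each stage. *)
Lemma tay_unique (f : C -> C) (a0 a1 a2 b0 b1 b2 : C) :
  tay f a0 a1 a2 -> tay f b0 b1 b2 -> a0 = b0 /\ a1 = b1 /\ a2 = b2.
Proof.
  intros Ha Hb.
  assert (H : bigO3 (fun h => (a0 - b0) + (a1 - b1) * h + (a2 - b2) * (h * h))).
  { eapply bigO3_ext; [|apply (bigO3_plus _ _ Hb (bigO3_mult _ _ (locb_const (-1)) Ha))].
    intros; simpl; ring. }
  destruct H as (d0 & K & Hd0 & HK & H).
  set (d := Rmin d0 1). assert (Hd : (0 < d)%R) by (apply Rmin_glb_lt; lra).
  assert (Hdd : (d <= d0)%R) by apply Rmin_l. assert (Hd1 : (d <= 1)%R) by apply Rmin_r.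
  assert (E0 : a0 - b0 = 0).
  { apply (C_zero_of_small _ d (K + Cmod (a1 - b1) + Cmod (a2 - b2))%R Hd). intros t Ht.
    specialize (H t). rewrite Cmod_t in H by lra. specialize (H ltac:(lra)).
    replace (a0 - b0) with ((a0 - b0 + (a1 - b1) * t + (a2 - b2) * (t * t)) + (- ((a1 - b1) * t) + - ((a2 - b2) * (t * t)))) by ring.
    eapply Rle_trans; [apply Cmod_triangle|].
    pose proof (Cmod_triangle (- ((a1 - b1) * t)) (- ((a2 - b2) * (t * t)))) as HT.
    rewrite !Cmod_opp, !Cmod_mult, Cmod_t in HT by lra.
    pose proof (Cmod_ge_0 (a2 - b2)).
    assert (Cmod (a2 - b2) * (t * t) <= Cmod (a2 - b2) * t)%R by (apply Rmult_le_compat_l; auto; nra).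
    assert (K * t ^ 3 <= K * t)%R by (apply Rmult_le_compat_l; auto; simpl; nra). lra. }
  rewrite E0 in H.
  assert (E1 : a1 - b1 = 0).
  { apply (C_zero_of_small _ d (K + Cmod (a2 - b2))%R Hd). intros t Ht.
    specialize (H t). rewrite Cmod_t in H by lra. specialize (H ltac:(lra)).
    replace (0 + (a1 - b1) * t + (a2 - b2) * (t * t)) with (t * ((a1 - b1) + (a2 - b2) * t)) in H by ring.
    rewrite Cmod_mult, Cmod_t in H by lra.
    assert (Cmod ((a1 - b1) + (a2 - b2) * t) <= K * t ^ 2)%R.
    { apply Rmult_le_reg_l with t. lra. eapply Rle_trans; [apply H|]. right; ring. }
    replace (a1 - b1) with ((a1 - b1) + (a2 - b2) * t + - ((a2 - b2) * t)) by ring.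
    eapply Rle_trans; [apply Cmod_triangle|]. rewrite Cmod_opp, Cmod_mult, Cmod_t by lra.
    assert (K * t ^ 2 <= K * t)%R by (apply Rmult_le_compat_l; auto; simpl; nra). lra. }
  rewrite E1 in H.
  assert (E2 : a2 - b2 = 0).
  { apply (C_zero_of_small _ d K Hd). intros t Ht.
    specialize (H t). rewrite Cmod_t in H by lra. specialize (H ltac:(lra)).
    replace (0 + 0 * t + (a2 - b2) * (t * t)) with (t * t * (a2 - b2)) in H by ring.
    rewrite !Cmod_mult, Cmod_t in H by lra.
    apply Rmult_le_reg_l with (t * t)%R. nra. eapply Rle_trans; [apply H|]. right; ring. }
  repeat split.
  - replace a0 with ((a0 - b0) + b0) by ring. rewrite E0; ring.
  - replace a1 with ((a1 - b1) + b1) by ring. rewrite E1; ring.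
  - replace a2 with ((a2 - b2) + b2) by ring. rewrite E2; ring.
Qed.

Lemma tay_continuous (f : C -> C) (a0 a1 a2 : C) (eps : R) : tay f a0 a1 a2 -> (0 < eps)%R ->
  exists d, (0 < d)%R /\ forall h, (Cmod h < d)%R -> (Cmod (f h - a0) < eps)%R.
Proof.
  intros (d & K & Hd & HK & H) He.
  set (M := (K + Cmod a1 + Cmod a2 + 1)%R).
  pose proof (Cmod_ge_0 a1). pose proof (Cmod_ge_0 a2).
  assert (HM : (0 < M)%R) by (unfold M; lra).
  exists (Rmin (Rmin d 1) (eps / M)). split.
  { repeat apply Rmin_glb_lt; try lra. apply Rdiv_lt_0_compat; lra. }
  intros h Hh. pose proof (Rmin_l (Rmin d 1) (eps / M)). pose proof (Rmin_r (Rmin d 1) (eps / M)).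
  pose proof (Rmin_l d 1). pose proof (Rmin_r d 1). pose proof (Cmod_ge_0 h).
  specialize (H h ltac:(lra)).
  replace (f h - a0) with ((f h - (a0 + a1 * h + a2 * (h * h))) + (a1 * h + a2 * (h * h))) by ring.
  apply Rle_lt_trans with (M * Cmod h)%R.
  - eapply Rle_trans; [apply Cmod_triangle|]. pose proof (Cmod_triangle (a1 * h) (a2 * (h * h))) as HT.
    rewrite !Cmod_mult in HT. set (x := Cmod h) in *.
    assert (x * x <= x)%R by nra. assert (x ^ 3 <= x)%R by (simpl; nra).
    assert (K * x ^ 3 <= K * x)%R by (apply Rmult_le_compat_l; auto).
    assert (Cmod a2 * (x * x) <= Cmod a2 * x)%R by (apply Rmult_le_compat_l; auto).
    unfold M. nra.
  - replace eps with (M * (eps / M))%R by (field; lra). apply Rmult_lt_compat_l; lra.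
Qed.

Lemma tay_inv (f : C -> C) (a0 a1 a2 : C) : a0 <> 0 -> tay f a0 a1 a2 ->
  tay (fun h => / f h) (/ a0) (- a1 / (a0 * a0)) (a1 * a1 / (a0 * a0 * a0) - a2 / (a0 * a0)).
Proof.
  intros Ha H.
  set (b0 := / a0). set (b1 := - a1 / (a0 * a0)). set (b2 := a1 * a1 / (a0 * a0 * a0) - a2 / (a0 * a0)).
  (* The candidate polynomial is the inverse of f up to O(h^3); multiplying f P - 1 by 1/f, which is
     bounded near 0 as a0 is nonzero, gives the remainder. *)
  assert (P : tay (fun h => f h * (b0 + b1 * h + b2 * (h * h))) 1 0 0).
  { eapply tay_eq; [apply tay_mult; [exact H|apply tay_poly]|..]; unfold b0, b1, b2; field; auto. }
  assert (Hpos : (0 < Cmod a0)%R) by now apply Cmod_gt_0.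
  destruct (tay_continuous f a0 a1 a2 (Cmod a0 / 2) H ltac:(lra)) as (d & Hd & Hf).
  assert (Hlow : forall h, (Cmod h < d)%R -> (Cmod a0 / 2 <= Cmod (f h))%R).
  { intros h Hh. specialize (Hf h Hh). pose proof (Cmod_triangle (f h) (- (f h - a0))).
    replace (f h + - (f h - a0)) with a0 in H0 by ring. rewrite Cmod_opp in H0. lra. }
  assert (Hnz : forall h, (Cmod h < d)%R -> f h <> 0).
  { intros h Hh E. specialize (Hlow h Hh). rewrite E, Cmod_0 in Hlow. lra. }
  assert (B : locb (fun h => / f h)).
  { exists d, (/ (Cmod a0 / 2))%R. split; auto. split. left. apply Rinv_0_lt_compat. lra.
    intros h Hh. rewrite Cmod_inv by auto. apply Rinv_le_contravar; auto. lra. }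
  pose proof (bigO3_mult _ _ (locb_const (-1)) (bigO3_mult _ _ B P)) as (d' & K & Hd' & HK & HB).
  exists (Rmin d d'), K. split; [apply Rmin_glb_lt; auto|split; auto].
  intros h Hh. pose proof (Rmin_l d d'). pose proof (Rmin_r d d').
  specialize (HB h ltac:(lra)). simpl in HB.
  match goal with |- (Cmod ?z <= _)%R => match type of HB with (Cmod ?z' <= _)%R => replace z with z'; [exact HB|] end end.
  field. apply Hnz. lra.
Qed.

(** * Termwise expansion of exponential and Gaussian series *)

Lemma pow_le_exp (d x : R) : (0 < d)%R -> (0 <= x)%R ->
  (x <= / d * exp (d * x) /\ x ^ 2 <= 4 / d ^ 2 * exp (d * x) /\ x ^ 3 <= 27 / d ^ 3 * exp (d * x))%R.
Proof.
  intros Hd Hx. assert (H : forall y, (0 <= y)%R -> (y <= exp y)%R).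
  { intros y Hy. pose proof (exp_ineq1_le y). lra. }
  assert (Hdx : (0 <= d * x)%R) by nra.
  repeat split.
  - apply Rmult_le_reg_l with d; auto. replace (d * (/ d * exp (d * x)))%R with (exp (d * x)) by (field; lra). auto.
  (* Squaring y <= e^y at y = dx/2 gives the 4 = 2^2; the cubic case cubes it at dx/3, giving 27 =
     3^3. *)
  - assert (E : (exp (d * x) = exp (d * x / 2) ^ 2)%R). { simpl. rewrite Rmult_1_r, <- exp_plus. f_equal. field. }
    rewrite E. assert (d * x / 2 <= exp (d * x / 2))%R by (apply H; lra).
    replace (x ^ 2)%R with (4 / d ^ 2 * (d * x / 2) ^ 2)%R by (field; lra).
    apply Rmult_le_compat_l. left. apply Rdiv_lt_0_compat. lra. apply pow_lt; auto. apply pow_incr. lra.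
  - assert (E : (exp (d * x) = exp (d * x / 3) ^ 3)%R). { simpl. rewrite Rmult_1_r, <- !exp_plus. f_equal. field. }
    rewrite E. assert (d * x / 3 <= exp (d * x / 3))%R by (apply H; lra).
    replace (x ^ 3)%R with (27 / d ^ 3 * (d * x / 3) ^ 3)%R by (field; lra).
    apply Rmult_le_compat_l. left. apply Rdiv_lt_0_compat. lra. apply pow_lt; auto. apply pow_incr. lra.
Qed.

(** The cubic Taylor remainder of each exponential is summed. Of the weight e^(2d|lam|), one half
    bounds e^(lam h) for |h| < d and the other absorbs |lam|^3. *)
Lemma Zsum_tay (c : Z -> C) (lam : Z -> R) (d K : R) : (0 < d)%R ->
  (forall n, (Cmod (c n) * exp (2 * d * Rabs (lam n)) <= K * exp (- Rabs (IZR n)))%R) ->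
  tay (fun h => Zsum (fun n => c n * cexp (lam n * h)))
      (Zsum c) (Zsum (fun n => lam n * c n)) (Zsum (fun n => (lam n * lam n / 2) * c n)).
Proof.
  intros Hd H.
  assert (HK : (0 <= K)%R).
  { specialize (H 0%Z). rewrite Rabs_R0, Ropp_0, exp_0 in H.
    pose proof (Cmod_ge_0 (c 0%Z)). pose proof (exp_pos (2 * d * Rabs (lam 0%Z))). nra. }
  assert (Hpow : forall n, (0 <= d * Rabs (lam n))%R). { intros n. pose proof (Rabs_pos (lam n)). nra. }
  assert (Hdom : forall (f : Z -> C) (B : R), (0 <= B)%R ->
     (forall n, (Cmod (f n) <= B * exp (2 * d * Rabs (lam n)) * Cmod (c n))%R) ->
     forall n, (Cmod (f n) <= (B * K) * exp (- Rabs (IZR n)))%R).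
  { intros f B HB Hf n. eapply Rle_trans; [apply Hf|]. rewrite !Rmult_assoc.
    apply Rmult_le_compat_l; auto. rewrite Rmult_comm. rewrite <- (Rmult_assoc 2). apply H. }
  assert (E1 : forall n, (exp (d * Rabs (lam n)) <= exp (2 * d * Rabs (lam n)))%R).
  { intros n. apply exp_le. specialize (Hpow n). lra. }
  assert (D0 : edom c).
  { exists (1 * K)%R. apply Hdom. lra. intros n. rewrite Rmult_1_l.
    assert (1 <= exp (2 * d * Rabs (lam n)))%R. { rewrite <- exp_0. apply exp_le. specialize (Hpow n). lra. }
    pose proof (Cmod_ge_0 (c n)). nra. }
  assert (D1 : edom (fun n => lam n * c n)).
  { exists (/ d * K)%R. apply Hdom. left; now apply Rinv_0_lt_compat. intros n. rewrite Cmod_mult, Cmod_R.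
    apply Rmult_le_compat_r. apply Cmod_ge_0. destruct (pow_le_exp d (Rabs (lam n)) Hd (Rabs_pos _)) as [A _].
    eapply Rle_trans; [apply A|]. apply Rmult_le_compat_l; auto. left; now apply Rinv_0_lt_compat. }
  assert (D2 : edom (fun n => (lam n * lam n / 2) * c n)).
  { exists (4 / d ^ 2 * K)%R.
    assert (Hp : (0 <= 4 / d ^ 2)%R) by (left; apply Rdiv_lt_0_compat; [lra|apply pow_lt; auto]).
    apply Hdom; auto. intros n.
    rewrite Cmod_mult. apply Rmult_le_compat_r. apply Cmod_ge_0.
    destruct (pow_le_exp d (Rabs (lam n)) Hd (Rabs_pos _)) as [_ [A _]].
    replace (lam n * lam n / 2) with (Complex.RtoC (lam n * lam n / 2)) by (rewrite RtoC_div, RtoC_mult; auto; lra).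
    rewrite Cmod_R. apply Rle_trans with (Rabs (lam n) ^ 2)%R.
    - replace (lam n * lam n / 2)%R with ((/ 2) * (lam n * lam n))%R by field.
      rewrite !Rabs_mult, (Rabs_pos_eq (/ 2)) by lra. pose proof (Rabs_pos (lam n)). nra.
    - eapply Rle_trans; [apply A|]. apply Rmult_le_compat_l; auto. }
  assert (De : forall h, (Cmod h < d)%R -> edom (fun n => c n * cexp (lam n * h))).
  { intros h Hh. exists (1 * K)%R. apply Hdom. lra. intros n. rewrite Cmod_mult, Rmult_1_l, Rmult_comm.
    apply Rmult_le_compat_r. apply Cmod_ge_0. rewrite Cmod_Cexp. apply exp_le.
    assert (Hf : (fst (lam n * h)%C <= Cmod (lam n * h)%C)%R).
    { eapply Rle_trans; [apply Rle_abs|]. apply re_le_Cmod. }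
    eapply Rle_trans; [apply Hf|]. rewrite Cmod_mult, Cmod_R. pose proof (Rabs_pos (lam n)). nra. }
  destruct summable_exp as [_ [M HM]].
  assert (HM0 : (0 <= M)%R) by apply (HM O).
  exists d, (2 * (8 * (27 / d ^ 3) * K) * M)%R. split; auto.
  assert (Hp : (0 <= 27 / d ^ 3)%R) by (left; apply Rdiv_lt_0_compat; [lra|apply pow_lt; auto]).
  split. { repeat apply Rmult_le_pos; auto; lra. }
  intros h Hh.
  set (r := fun n => c n * (cexp (lam n * h) - 1 - lam n * h - (lam n * h) * (lam n * h) / 2)).
  assert (E : Zsum (fun n => c n * cexp (lam n * h)) -
     (Zsum c + Zsum (fun n => lam n * c n) * h + Zsum (fun n => lam n * lam n / 2 * c n) * (h * h)) = Zsum r).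
  { rewrite <- (Zsum_scal_r _ h) by auto. rewrite <- (Zsum_scal_r _ (h * h)) by auto.
    assert (D1' : edom (fun n => lam n * c n * h)).
    { apply edom_le with (fun n => lam n * c n) (Cmod h); auto. apply Cmod_ge_0. intros. rewrite (Cmod_mult _ h). lra. }
    assert (D2' : edom (fun n => lam n * lam n / 2 * c n * (h * h))).
    { apply edom_le with (fun n => lam n * lam n / 2 * c n) (Cmod (h * h)); auto. apply Cmod_ge_0.
      intros. rewrite (Cmod_mult _ (h * h)). lra. }
    rewrite <- Zsum_plus by auto. rewrite <- Zsum_plus; auto.
    2:{ apply edom_plus; auto. }
    match goal with |- ?a - ?b = _ => replace (a - b) with (a + (-1) * b) by ring end.
    rewrite <- Zsum_scal by (apply edom_plus; auto; apply edom_plus; auto).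
    rewrite <- Zsum_plus; auto. 2:{ apply edom_scal. apply edom_plus; auto; apply edom_plus; auto. }
    apply Zsum_ext. intros n. unfold r. field. }
  rewrite E.
  eapply Rle_trans; [apply (Zsum_bound r (8 * (27 / d ^ 3) * Cmod h ^ 3 * K)) with (M := M); auto|right; ring].
  apply Hdom. { pose proof (pow_le (Cmod h) 3 (Cmod_ge_0 h)). apply Rmult_le_pos; auto. lra. }
  intros n. unfold r. rewrite Cmod_mult, Rmult_comm. apply Rmult_le_compat_r. apply Cmod_ge_0.
  eapply Rle_trans; [apply Cexp_taylor2|]. rewrite Cmod_mult, Cmod_R.
  destruct (pow_le_exp d (Rabs (lam n)) Hd (Rabs_pos _)) as [_ [_ A]].
  rewrite Rpow_mult_distr.
  assert (E2 : (exp (Rabs (lam n) * Cmod h) <= exp (d * Rabs (lam n)))%R).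
  { apply exp_le. pose proof (Rabs_pos (lam n)). nra. }
  assert (E3 : (exp (2 * d * Rabs (lam n)) = exp (d * Rabs (lam n)) * exp (d * Rabs (lam n)))%R).
  { rewrite <- exp_plus. f_equal. ring. }
  rewrite E3. pose proof (pow_le (Cmod h) 3 (Cmod_ge_0 h)) as Ph.
  pose proof (pow_le (Rabs (lam n)) 3 (Rabs_pos _)) as Pl.
  set (e := exp (d * Rabs (lam n))) in *. pose proof (exp_pos (Rabs (lam n) * Cmod h)).
  replace (8 * (27 / d ^ 3) * Cmod h ^ 3 * (e * e))%R with (8 * ((27 / d ^ 3 * e) * Cmod h ^ 3) * e)%R by ring.
  apply Rmult_le_compat; auto.
  - apply Rmult_le_pos. lra. apply Rmult_le_pos; auto.
  - left; apply exp_pos.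
  - apply Rmult_le_compat_l. lra. apply Rmult_le_compat_r; auto.
Qed.

Definition gs1 (A B : C) : C := Zsum (fun n => IZR n * gterm A B n).
Definition gs2 (A B : C) : C := Zsum (fun n => IZR n * IZR n / 2 * gterm A B n).
Definition gs4 (A B : C) : C := Zsum (fun n => IZR (n * n) * IZR (n * n) / 2 * gterm A B n).

Lemma gs_tay_lin (A B : C) : (fst A < 0)%R -> tay (fun h => gs A (B + h)) (gs A B) (gs1 A B) (gs2 A B).
Proof.
  intros HA. destruct (gterm_bound A B 2 HA) as [K [HK H]].
  eapply tay_ext; [|apply (Zsum_tay (gterm A B) IZR (1/2) K); [lra|]].
  - intros h. apply Zsum_ext. intros n. unfold gterm. rewrite <- Cexp_plus. f_equal. ring.
  - intros n. replace (2 * (1 / 2) * Rabs (IZR n))%R with (Rabs (IZR n)) by field.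
    eapply Rle_trans; [apply Rmult_le_compat_r; [left; apply exp_pos|apply H]|].
    rewrite Rmult_assoc, <- exp_plus. right. f_equal. f_equal. ring.
Qed.

(** This contains the heat equation: moving A by h multiplies the n-th term by e^(n^2 h), so the
    linear coefficient is the sum of n^2, twice the quadratic coefficient obtained by moving B. *)
Lemma gs_tay_quad (A B : C) : (fst A < 0)%R ->
  tay (fun h => gs (A + h) B) (gs A B) (2 * gs2 A B) (gs4 A B).
Proof.
  intros HA. destruct (gauss_bound (fst A / 2) (fst B) 1 ltac:(lra)) as [K [HK H]].
  (* With this radius the weight e^(2d n^2) uses up half of the Gaussian decay and leaves the
     exponent A/2. *)
  assert (HA4 : (0 < - fst A / 4)%R) by lra.
  pose proof (Zsum_tay (gterm A B) (fun n => IZR (n * n)) (- fst A / 4) K HA4) as T.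
  replace (2 * gs2 A B) with (Zsum (fun n => IZR (n * n) * gterm A B n)).
  - eapply tay_ext; [|apply T].
    + intros h. apply Zsum_ext. intros n. unfold gterm. rewrite <- Cexp_plus. f_equal. rewrite mult_IZR, RtoC_mult. ring.
    + intros n. rewrite Cmod_gterm, <- exp_plus, mult_IZR. rewrite (Rabs_pos_eq (IZR n * IZR n)) by nra.
      rewrite <- (Rmult_1_l (Rabs (IZR n))). eapply Rle_trans; [|apply H]. right. f_equal. field.
  - unfold gs2. rewrite <- Zsum_scal.
    + apply Zsum_ext. intros n. rewrite mult_IZR, RtoC_mult. field.
    + destruct (gterm_bound A B 2 HA) as [K' [HK' H']]. exists (2 * K')%R. intros n.
      rewrite Cmod_mult.
      replace (IZR n * IZR n / 2) with (Complex.RtoC (IZR n * IZR n / 2)) by (rewrite RtoC_div, RtoC_mult; auto; lra).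
      rewrite Cmod_R.
      destruct (pow_le_exp 1 (Rabs (IZR n)) ltac:(lra) (Rabs_pos _)) as [_ [P _]].
      replace (4 / 1 ^ 2)%R with 4%R in P by field. rewrite Rmult_1_l in P.
      assert (E : (Rabs (IZR n * IZR n / 2) = Rabs (IZR n) ^ 2 / 2)%R).
      { unfold Rdiv. rewrite !Rabs_mult, (Rabs_pos_eq (/ 2)) by lra. ring. }
      rewrite E. specialize (H' n).
      replace (2 * K' * exp (- Rabs (IZR n)))%R with ((2 * exp (Rabs (IZR n))) * (K' * exp (- (2 * Rabs (IZR n)))))%R.
      * apply Rmult_le_compat; auto. pose proof (pow2_ge_0 (Rabs (IZR n))). lra. apply Cmod_ge_0. lra.
      * replace (- Rabs (IZR n))%R with (Rabs (IZR n) + - (2 * Rabs (IZR n)))%R by ring. rewrite exp_plus. ring.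
Qed.

(** * The triple product *)

(* [gp P z N] and [G P z] are the products [(e^z; e^P)_N] and [(e^z; e^P)_oo]. *)
Fixpoint gp (P z : C) (N : nat) : C :=
  match N with O => 1 | S n => gp P z n * (1 - cexp (z + INR n * P)) end.
Definition G (P z : C) : C := epsilon (inhabits (0 : C)) (fun l => cv (gp P z) l).

Lemma gp_S (P z : C) (n : nat) : gp P z (S n) = gp P z n * (1 - cexp (z + INR n * P)).
Proof. reflexivity. Qed.

Lemma RtoC_INR_S (n : nat) : Complex.RtoC (INR (S n)) = INR n + 1.
Proof. rewrite S_INR, RtoC_plus. reflexivity. Qed.

Lemma Cmod_geom (P z : C) (j : nat) : Cmod (cexp (z + INR j * P)) = (exp (fst z) * exp (fst P) ^ j)%R.
Proof.
  rewrite Cmod_Cexp. simpl fst. rewrite exp_plus. f_equal.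
  induction j. simpl. rewrite <- exp_0. f_equal. ring.
  rewrite S_INR. replace ((INR j + 1) * fst P - 0 * snd P)%R with (fst P + (INR j * fst P - 0 * snd P))%R by ring.
  rewrite exp_plus, IHj. reflexivity.
Qed.

Lemma nome_lt_1 (P : C) : (fst P < 0)%R -> (0 <= exp (fst P) < 1)%R.
Proof. intros. split. left; apply exp_pos. rewrite <- exp_0. now apply exp_increasing. Qed.

Lemma gp_bound_rsum (P z : C) (N : nat) :
  (Cmod (gp P z N) <= exp (rsum (fun j => exp (fst z) * exp (fst P) ^ j) N))%R.
Proof.
  induction N; simpl. rewrite Cmod_1, exp_0; lra.
  rewrite Cmod_mult, exp_plus. apply Rmult_le_compat; try apply Cmod_ge_0; auto.
  eapply Rle_trans; [apply Cmod_triangle_minus|]. rewrite Cmod_1, Cmod_geom. apply exp_ineq1_le.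
Qed.

Lemma gp_bound (P z : C) : (fst P < 0)%R ->
  forall N, (Cmod (gp P z N) <= exp (exp (fst z) * / (1 - exp (fst P))))%R.
Proof.
  intros HP N. eapply Rle_trans; [apply gp_bound_rsum|]. apply exp_le. rewrite rsum_scal.
  apply Rmult_le_compat_l. left; apply exp_pos. apply rsum_geom. now apply nome_lt_1.
Qed.

Lemma gp_cv (P z : C) : (fst P < 0)%R -> cv (gp P z) (G P z).
Proof.
  intros HP. unfold G. apply epsilon_spec.
  set (B := exp (exp (fst z) * / (1 - exp (fst P)))).
  (* The partial products are telescoped into a series whose terms decay geometrically, since the
     products are bounded. *)
  destruct (csum_cv (fun j => gp P z (S j) - gp P z j) (fun j => (B * exp (fst z)) * exp (fst P) ^ j)%R) as [l Hl].
  - intros k. simpl. replace (gp P z k * (1 - cexp (z + INR k * P)) - gp P z k) with (- (gp P z k * cexp (z + INR k * P))) by ring.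
    rewrite Cmod_opp, Cmod_mult, Cmod_geom, Rmult_assoc. apply Rmult_le_compat_r.
    apply Rmult_le_pos. left; apply exp_pos. apply pow_le. left; apply exp_pos. now apply gp_bound.
  - apply summable_scal. apply Rmult_le_pos; left; apply exp_pos. apply summable_geom. now apply nome_lt_1.
  - exists (1 + l). apply cv_ext with (fun N => 1 + csum (fun j => gp P z (S j) - gp P z j) N).
    + induction n. simpl; ring. rewrite csum_S, Cplus_assoc, IHn. ring.
    + apply cv_plus; auto. apply cv_const.
Qed.

Lemma G_eq (P z l : C) : (fst P < 0)%R -> cv (gp P z) l -> G P z = l.
Proof. intros HP H. apply cv_unique with (gp P z); auto. now apply gp_cv. Qed.

(** Rests on 1 - x >= exp(-x/(1-r)) for x in [0, r], with r = |e^P|. Beyond nonvanishing of the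
    limit, uniformity in N is needed to dominate the Gaussian binomials in the triple product. *)
Lemma gp_lower (P : C) : (fst P < 0)%R -> exists c, (0 < c)%R /\ forall N, (c <= Cmod (gp P P N))%R.
Proof.
  intros HP. destruct (nome_lt_1 P HP) as [Hr0 Hr1]. set (r := exp (fst P)) in *.
  assert (Hlow : forall x, (0 <= x <= r)%R -> (exp (- (x / (1 - r))) <= 1 - x)%R).
  { intros x Hx. rewrite exp_Ropp. pose proof (exp_ineq1_le (x / (1 - x))).
    assert (exp (x / (1 - x)) <= exp (x / (1 - r)))%R.
    { apply exp_le. apply Rmult_le_compat_l. lra. apply Rinv_le_contravar; lra. }
    replace (1 + x / (1 - x))%R with (/ (1 - x))%R in H by (field; lra).
    rewrite <- (Rinv_inv (1 - x)). apply Rinv_le_contravar. apply Rinv_0_lt_compat; lra. lra. }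
  exists (exp (- (r * / (1 - r) / (1 - r)))). split. apply exp_pos. intros N.
  apply Rle_trans with (exp (- (rsum (fun j => r * r ^ j) N / (1 - r))))%R.
  - apply exp_le. apply Ropp_le_contravar. apply Rmult_le_compat_r. left; apply Rinv_0_lt_compat; lra.
    rewrite rsum_scal. apply Rmult_le_compat_l; auto. apply rsum_geom. lra.
  - induction N; simpl. rewrite Cmod_1. right. rewrite <- exp_0. f_equal. unfold Rdiv. ring.
    replace (- ((rsum (fun j => r * r ^ j) N + r * r ^ N) / (1 - r)))%R
      with (- (rsum (fun j => r * r ^ j) N / (1 - r)) + - (r * r ^ N / (1 - r)))%R by (field; lra).
    rewrite exp_plus, Cmod_mult. apply Rmult_le_compat; try (left; apply exp_pos); auto.
    assert (HN : (0 <= r ^ N <= 1)%R). { split. apply pow_le; auto. rewrite <- (pow1 N). apply pow_incr. lra. }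
    eapply Rle_trans; [apply Hlow; nra|].
    pose proof (Cmod_triangle (1 - cexp (P + INR N * P)) (cexp (P + INR N * P))) as HT.
    replace (1 - cexp (P + INR N * P) + cexp (P + INR N * P)) with (1 : C) in HT by ring.
    rewrite Cmod_1, Cmod_geom in HT. fold r in HT. lra.
Qed.

Lemma G_neq_0 (P : C) : (fst P < 0)%R -> G P P <> 0.
Proof.
  intros HP. destruct (gp_lower P HP) as [c [Hc H]].
  apply Cmod_gt_0. apply Rlt_le_trans with c; auto. apply cv_lower_bound with (gp P P); auto. now apply gp_cv.
Qed.

Lemma gp_add (P z : C) (n m : nat) : gp P z (n + m) = gp P z n * gp P (z + INR n * P) m.
Proof.
  induction m. rewrite Nat.add_0_r. simpl. ring.
  rewrite Nat.add_succ_r. simpl. rewrite IHm, plus_INR, RtoC_plus.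
  replace (z + (INR n + INR m) * P) with (z + INR n * P + INR m * P) by ring. ring.
Qed.

Lemma gp_first (P z : C) (n : nat) : gp P z (S n) = (1 - cexp z) * gp P (z + P) n.
Proof.
  change (S n) with (1 + n)%nat. rewrite gp_add. simpl.
  replace (z + 0 * P) with z by ring. replace (z + 1 * P) with (z + P) by ring. ring.
Qed.

Lemma G_head (P z : C) : (fst P < 0)%R -> G P z = (1 - cexp z) * G P (z + P).
Proof.
  intros HP. apply cv_unique with (fun n => gp P z (S n)).
  - apply (cv_subseq (gp P z) _ S). intros; lia. now apply gp_cv.
  - apply cv_ext with (fun n => (1 - cexp z) * gp P (z + P) n). intros; now rewrite gp_first.
    apply cv_scal. now apply gp_cv.
Qed.

Lemma G_dissect2 (P z : C) : (fst P < 0)%R -> G P z = G (2 * P) z * G (2 * P) (z + P).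
Proof.
  intros HP. assert (HP2 : (fst (2 * P)%C < 0)%R) by (simpl; lra).
  apply cv_unique with (fun n => gp P z (2 * n)).
  - apply (cv_subseq (gp P z) _ (fun n => (2 * n)%nat)). intros; lia. now apply gp_cv.
  - eapply cv_ext; [|apply cv_mult; apply gp_cv; auto]. intros n. cbv beta.
    induction n as [|n IH]. simpl; ring.
    replace (2 * S n)%nat with (S (S (2 * n))) by lia. rewrite !gp_S, <- IH.
    rewrite RtoC_INR_S, mult_INR, RtoC_mult. change (INR 2) with 2%R.
    replace (z + INR n * (2 * P)) with (z + 2 * INR n * P) by ring.
    replace (z + P + INR n * (2 * P)) with (z + (2 * INR n + 1) * P) by ring.
    ring.
Qed.

Lemma G_dissect3 (P z : C) : (fst P < 0)%R ->
  G P z = G (3 * P) z * G (3 * P) (z + P) * G (3 * P) (z + 2 * P).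
Proof.
  intros HP. assert (HP3 : (fst (3 * P)%C < 0)%R) by (simpl; lra).
  apply cv_unique with (fun n => gp P z (3 * n)).
  - apply (cv_subseq (gp P z) _ (fun n => (3 * n)%nat)). intros; lia. now apply gp_cv.
  - eapply cv_ext; [|apply cv_mult; [apply cv_mult|]; apply gp_cv; auto]. intros n. cbv beta.
    induction n as [|n IH]. simpl; ring.
    replace (3 * S n)%nat with (S (S (S (3 * n)))) by lia. rewrite !gp_S, <- IH.
    rewrite !RtoC_INR_S, mult_INR, RtoC_mult. replace (INR 3) with 3%R by (simpl; ring).
    replace (z + INR n * (3 * P)) with (z + 3 * INR n * P) by ring.
    replace (z + P + INR n * (3 * P)) with (z + (3 * INR n + 1) * P) by ring.
    replace (z + 2 * P + INR n * (3 * P)) with (z + (3 * INR n + 1 + 1) * P) by ring.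
    ring.
Qed.

(** Factor by factor this is (1 - y)(1 + y) = 1 - y^2; it is the tool for removing arguments twisted
    by [iPI]. *)
Lemma G_square (P z : C) : (fst P < 0)%R -> G P z * G P (z + iPI) = G (2 * P) (2 * z).
Proof.
  intros HP. assert (HP2 : (fst (2 * P)%C < 0)%R) by (simpl; lra).
  apply cv_unique with (fun n => gp P z n * gp P (z + iPI) n).
  - apply cv_mult; now apply gp_cv.
  - apply cv_ext with (gp (2 * P) (2 * z)); [|now apply gp_cv]. intros n.
    induction n as [|n IH]. simpl; ring. rewrite !gp_S, IH.
    replace (z + iPI + INR n * P) with (z + INR n * P + iPI) by ring.
    replace (2 * z + INR n * (2 * P)) with (z + INR n * P + (z + INR n * P)) by ring.
    rewrite !Cexp_plus, Cexp_iPI. ring.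
Qed.

Lemma Cexp_period (z : C) : cexp (z + 2 * iPI) = cexp z.
Proof.
  rewrite Cexp_plus. replace (2 * iPI) with (2 * (IZR 1) * iPI) by ring. rewrite Cexp_iPI_even. ring.
Qed.

Lemma G_period (P z : C) : (fst P < 0)%R -> G P (z + 2 * iPI) = G P z.
Proof.
  intros HP. apply G_eq; auto. apply cv_ext with (gp P z); [|now apply gp_cv].
  intros n. induction n as [|n IH]; auto. rewrite !gp_S, IH.
  replace (z + 2 * iPI + INR n * P) with (z + INR n * P + 2 * iPI) by ring. now rewrite Cexp_period.
Qed.

(** Prepares continuity of the infinite product at z = P, needed for T'(0). Each factor has modulus
    at most 1 + 2e <= e^(2e), and the product of these bounds is the exp(2S); the constant S exp(2S)
    reproduces itself in the induction. *)
Lemma gp_lipschitz (P s : C) (N : nat) : (Cmod (cexp s) <= 2)%R ->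
  let S := rsum (fun j => exp (fst P) * exp (fst P) ^ j)%R N in
  (Cmod (gp P (P + s) N - gp P P N) <= Cmod (cexp s - 1) * (S * exp (2 * S)))%R.
Proof.
  intros Hs. induction N as [|N IH]; simpl.
  - replace (1 - 1) with (0 : C) by ring. rewrite Cmod_0. lra.
  - simpl in IH. set (S := rsum (fun j => exp (fst P) * exp (fst P) ^ j)%R N) in *.
    assert (HB : (Cmod (gp P P N) <= exp (2 * S))%R).
    { eapply Rle_trans; [apply gp_bound_rsum|]. apply exp_le. fold S.
      assert (0 <= S)%R. { apply (rsum_mono (fun j => exp (fst P) * exp (fst P) ^ j)%R 0 N); [|lia].
        intros n. apply Rmult_le_pos. left; apply exp_pos. apply pow_le. left; apply exp_pos. } lra. }
    assert (HS : (0 <= S)%R). { apply (rsum_mono (fun j => exp (fst P) * exp (fst P) ^ j)%R 0 N); [|lia].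
        intros n. apply Rmult_le_pos. left; apply exp_pos. apply pow_le. left; apply exp_pos. }
    pose proof (Cmod_geom P P N) as Hx. set (x := cexp (P + INR N * P)) in *.
    replace (cexp (P + s + INR N * P)) with (x * cexp s) by (unfold x; rewrite <- Cexp_plus; f_equal; ring).
    set (e := (exp (fst P) * exp (fst P) ^ N)%R) in *.
    assert (He : (0 <= e)%R). { apply Rmult_le_pos. left; apply exp_pos. apply pow_le. left; apply exp_pos. }
    replace (gp P (P + s) N * (1 - x * cexp s) - gp P P N * (1 - x)) with
      ((gp P (P + s) N - gp P P N) * (1 - x * cexp s) + - (gp P P N * x * (cexp s - 1))) by ring.
    eapply Rle_trans; [apply Cmod_triangle|]. rewrite Cmod_opp, !Cmod_mult, Hx.
    assert (H1 : (Cmod (1 - x * cexp s) <= exp (2 * e))%R).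
    { eapply Rle_trans; [apply Cmod_triangle_minus|]. rewrite Cmod_1, Cmod_mult, Hx.
      pose proof (exp_ineq1_le (2 * e)). nra. }
    set (w := Cmod (cexp s - 1)) in *. assert (Hw : (0 <= w)%R) by apply Cmod_ge_0.
    replace (2 * (S + e))%R with (2 * S + 2 * e)%R by ring. rewrite exp_plus.
    assert (H2 : (1 <= exp (2 * e))%R) by (rewrite <- exp_0; apply exp_le; lra).
    pose proof (exp_pos (2 * S)) as H3. set (a := exp (2 * S)) in *. set (b := exp (2 * e)) in *.
    apply Rle_trans with (w * (S * a) * b + a * e * w)%R.
    + apply Rplus_le_compat. apply Rmult_le_compat; auto; apply Cmod_ge_0.
      apply Rmult_le_compat_r; auto. apply Rmult_le_compat_r; auto.
    + assert (a * e * w * 1 <= a * e * w * b)%R. { apply Rmult_le_compat_l; auto. apply Rmult_le_pos; auto. apply Rmult_le_pos; auto. lra. }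
      lra.
Qed.

Lemma G_lipschitz (P : C) : (fst P < 0)%R ->
  exists K, (0 <= K)%R /\ forall s, (Cmod (cexp s) <= 2)%R -> (Cmod (G P (P + s) - G P P) <= K * Cmod (cexp s - 1))%R.
Proof.
  intros HP. pose proof (nome_lt_1 P HP) as Hr. set (r := exp (fst P)) in *.
  set (M := (r * / (1 - r))%R).
  assert (HM : (0 <= M)%R). { apply Rmult_le_pos. lra. left. apply Rinv_0_lt_compat. lra. }
  exists (M * exp (2 * M))%R. split. apply Rmult_le_pos; auto. left; apply exp_pos.
  intros s Hs. apply cv_upper_bound with (fun N => gp P (P + s) N - gp P P N);
    [|apply cv_minus; now apply gp_cv].
  intros N. eapply Rle_trans; [apply gp_lipschitz; auto|]. rewrite Rmult_comm.
  apply Rmult_le_compat_r. apply Cmod_ge_0. fold r. rewrite rsum_scal.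
  assert (HS : (r * rsum (fun j => r ^ j) N <= M)%R). { apply Rmult_le_compat_l. lra. apply rsum_geom; auto. }
  assert (H0 : (0 <= r * rsum (fun j => r ^ j) N)%R).
  { apply Rmult_le_pos. lra. apply (rsum_mono (fun j => r ^ j) 0 N)%R; [|lia]. intros; apply pow_le; lra. }
  apply Rmult_le_compat; auto. left; apply exp_pos. apply exp_le. apply Rmult_le_compat_l; [lra|exact HS].
Qed.

(* Gaussian binomial coefficients in base [e^P]. *)
Fixpoint qb (P : C) (M k : nat) : C :=
  match M, k with
  | O, O => 1
  | O, S _ => 0
  | S m, O => 1
  | S m, S l => qb P m l + cexp (INR (S l) * P) * qb P m (S l)
  end.

Lemma qb_0 (P : C) (M : nat) : qb P M 0 = 1.
Proof. destruct M; reflexivity. Qed.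

Lemma qb_S (P : C) (M k : nat) : qb P (S M) (S k) = qb P M k + cexp (INR (S k) * P) * qb P M (S k).
Proof. reflexivity. Qed.

Lemma qb_gt (P : C) (M k : nat) : (M < k)%nat -> qb P M k = 0.
Proof.
  revert k. induction M; intros [|k] H; try lia; auto.
  rewrite qb_S, !IHM by lia. ring.
Qed.

Lemma gp_self_S (P : C) (n : nat) : gp P P (S n) = gp P P n * (1 - cexp (INR (S n) * P)).
Proof. rewrite gp_S, RtoC_INR_S. do 3 f_equal. ring. Qed.

(** The product formula for Gaussian binomials, cleared of denominators. The Pascal rule matches (1
    - p^a) + p^a (1 - p^b) = 1 - p^(a+b). *)
Lemma qb_formula (P : C) (k l : nat) : qb P (k + l) k * gp P P k * gp P P l = gp P P (k + l).
Proof.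
  assert (H : forall M k l, (k + l = M)%nat -> qb P M k * gp P P k * gp P P l = gp P P M).
  { clear. induction M as [|M IH]; intros k l E.
    - replace k with O by lia. replace l with O by lia. simpl. ring.
    - destruct k as [|k]. { rewrite qb_0. simpl in E. subst l. simpl (gp P P 0). ring. }
      assert (E1 : qb P M k * gp P P k * gp P P l = gp P P M) by (apply IH; lia).
      destruct l as [|l].
      + rewrite qb_S, (qb_gt P M (S k)) by lia. replace k with M in * by lia.
        simpl (gp P P 0) in *. rewrite gp_self_S.
        replace ((qb P M M + cexp (INR (S M) * P) * 0) * (gp P P M * (1 - cexp (INR (S M) * P))) * 1)
          with (qb P M M * gp P P M * 1 * (1 - cexp (INR (S M) * P))) by ring.
        rewrite E1. reflexivity.
      + assert (E2 : qb P M (S k) * gp P P (S k) * gp P P l = gp P P M) by (apply IH; lia).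
        rewrite qb_S, (gp_self_S P M).
        replace ((qb P M k + cexp (INR (S k) * P) * qb P M (S k)) * gp P P (S k) * gp P P (S l))
          with (qb P M k * gp P P k * gp P P (S l) * (1 - cexp (INR (S k) * P))
             + cexp (INR (S k) * P) * (qb P M (S k) * gp P P (S k) * gp P P l) * (1 - cexp (INR (S l) * P)))
          by (rewrite (gp_self_S P k), (gp_self_S P l); ring).
        rewrite E1, E2. replace (S M) with (S k + S l)%nat by lia. rewrite plus_INR, RtoC_plus, Cmult_plus_distr_r, Cexp_plus. ring. }
  apply H. reflexivity.
Qed.

Definition qterm (P z : C) (k : nat) : C := cexp (P * (INR k * (INR k - 1)) / 2 + INR k * (z + iPI)).

(** Rothe's finite q-binomial theorem. The induction peels off the first factor and so uses the
    hypothesis at z + P, hence the inner quantifier over z. *)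
Lemma qbinomial (P : C) (M : nat) : forall z, gp P z M = csum (fun k => qb P M k * qterm P z k) (S M).
Proof.
  induction M as [|M IH]; intros z.
  - simpl. unfold qterm. simpl INR. replace (P * (0 * (0 - 1)) / 2 + 0 * (z + iPI)) with (0 : C) by field.
    rewrite Cexp_0. ring.
  - rewrite gp_first, csum_first, qb_0.
    rewrite (csum_ext _ (fun k => (- cexp z) * (qb P M k * qterm P (z + P) k) + qb P M (S k) * qterm P (z + P) (S k))).
    2:{ intros k _. rewrite qb_S. unfold qterm. rewrite RtoC_INR_S.
        replace (P * ((INR k + 1) * (INR k + 1 - 1)) / 2 + (INR k + 1) * (z + iPI))
          with (P * (INR k * (INR k - 1)) / 2 + INR k * (z + P + iPI) + (z + iPI)) by field.
        replace (P * ((INR k + 1) * (INR k + 1 - 1)) / 2 + (INR k + 1) * (z + P + iPI))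
          with ((P * (INR k * (INR k - 1)) / 2 + INR k * (z + P + iPI) + (z + iPI)) + (INR k + 1) * P) by field.
        rewrite (Cexp_plus (_ + _ + _) (_ * P)), (Cexp_plus (_ + _) (z + iPI)), (Cexp_plus z iPI), Cexp_iPI. ring. }
    rewrite csum_plus, csum_scal, <- IH.
    assert (E : qterm P z 0 = qterm P (z + P) 0). { unfold qterm. simpl INR. f_equal. field. }
    assert (E' : gp P (z + P) M = 1 * qterm P (z + P) 0 + csum (fun k => qb P M (S k) * qterm P (z + P) (S k)) (S M)).
    { set (F := fun k => qb P M k * qterm P (z + P) k).
      assert (EF : csum F (S (S M)) = csum F (S M)).
      { rewrite (csum_S F (S M)). unfold F at 2. rewrite qb_gt by lia. ring. }
      rewrite IH. fold F. rewrite <- EF, csum_first. unfold F at 1. rewrite qb_0. reflexivity. }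
    rewrite E.
    match goal with |- _ = ?a + (?b + ?c) => replace (a + (b + c)) with (b + (a + c)) by ring end.
    rewrite <- E'. ring.
Qed.

(** Each factor is inverted by 1 - y = -y (1 - 1/y); the prefactor collects the monomials -y. *)
Lemma gp_reflect (P z : C) (n : nat) :
  gp P (z - INR n * P) n = cexp (INR n * (z + iPI) - P * (INR n * (INR n + 1)) / 2) * gp P (P - z) n.
Proof.
  induction n as [|n IH].
  - simpl. replace (0 * (z + iPI) - P * (0 * (0 + 1)) / 2) with (0 : C) by field. rewrite Cexp_0. ring.
  - rewrite gp_first, gp_S, RtoC_INR_S.
    replace (z - (INR n + 1) * P + P) with (z - INR n * P) by ring. rewrite IH.
    replace ((INR n + 1) * (z + iPI) - P * ((INR n + 1) * (INR n + 1 + 1)) / 2)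
      with ((INR n * (z + iPI) - P * (INR n * (INR n + 1)) / 2) + ((z - (INR n + 1) * P) + iPI)) by field.
    replace (P - z + INR n * P) with (- (z - (INR n + 1) * P)) by ring.
    set (u := z - (INR n + 1) * P). rewrite (Cexp_plus _ (u + iPI)), (Cexp_plus u), Cexp_iPI, Cexp_opp.
    field. apply Cexp_neq_0.
Qed.

Definition jt (P z : C) (n : Z) : C := gterm (P / 2) (z + iPI - P / 2) n.

(** The q-binomial theorem for 2N+1 factors starting at z - (N+1)P. The first N+1 are reflected into
    powers of e^(-z), the other N stay; this uneven split puts the recentred indices in -(N+1), ...,
    N, exactly N+1 pairs of [zpair]. *)
Lemma jtp_finite (P z : C) (N : nat) :
  gp P (P - z) (S N) * gp P z N =
  csum (fun j => qb P (S N + N) (S N + j) * jt P z (Z.of_nat j)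
               + qb P (S N + N) (N - j) * jt P z (-1 - Z.of_nat j)%Z) (S N).
Proof.
  set (c := cexp (INR (S N) * (z + iPI) - P * (INR (S N) * (INR (S N) + 1)) / 2)).
  assert (Hc : c <> 0) by apply Cexp_neq_0.
  assert (H : c * (gp P (P - z) (S N) * gp P z N) = gp P (z - INR (S N) * P) (S N + N)).
  { rewrite gp_add, gp_reflect. fold c. replace (z - INR (S N) * P + INR (S N) * P) with z by ring. ring. }
  assert (Hk : forall k : nat, qterm P (z - INR (S N) * P) k = c * jt P z (Z.of_nat k - Z.of_nat (S N))%Z).
  { intros k. unfold c, jt, gterm, qterm. rewrite <- Cexp_plus. f_equal.
    rewrite minus_IZR, <- !INR_IZR_INZ, RtoC_minus. field. }
  rewrite (qbinomial P (S N + N)) in H. replace (S (S N + N)) with (S N + S N)%nat in H by lia.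
  rewrite csum_add, <- (csum_rev _ (S N)), Cplus_comm, <- csum_plus in H.
  replace (gp P (P - z) (S N) * gp P z N) with (/ c * (c * (gp P (P - z) (S N) * gp P z N))) by (field; auto).
  rewrite H, <- csum_scal. apply csum_ext. intros k Hk'. rewrite !Hk.
  replace (Z.of_nat (S N + k) - Z.of_nat (S N))%Z with (Z.of_nat k) by lia.
  replace (Z.of_nat (S N - S k) - Z.of_nat (S N))%Z with (-1 - Z.of_nat k)%Z by lia.
  replace (S N - S k)%nat with (N - k)%nat by lia. field. auto.
Qed.

Lemma cv_shift_back (u : nat -> C) (l : C) (phi : nat -> nat) (j : nat) :
  (forall n, (phi n + j >= n)%nat) -> cv u l -> cv (fun n => u (phi n)) l.
Proof.
  intros Hp H eps He. destruct (H eps He) as [N HN]. exists (N + j)%nat. intros n Hn.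
  apply HN. specialize (Hp n). lia.
Qed.

(* The finite product formula passes to the limit by dominated convergence. *)
Lemma jacobi_triple_product (P z : C) : (fst P < 0)%R ->
  gs (P / 2) (z + iPI - P / 2) = G P P * G P z * G P (P - z).
Proof.
  intros HP. assert (HP2 : (fst (P / 2)%C < 0)%R) by (simpl; lra).
  pose proof (G_neq_0 P HP) as Hf. set (f := G P P) in *.
  destruct (gp_lower P HP) as [c [Hc Hlow]].
  set (B := exp (exp (fst P) * / (1 - exp (fst P)))).
  assert (HB : forall N, (Cmod (gp P P N) <= B)%R) by now apply gp_bound.
  assert (Hnz : forall N, gp P P N <> 0).
  { intros N E. specialize (Hlow N). rewrite E, Cmod_0 in Hlow. lra. }
  assert (Hq : forall k l, qb P (k + l) k = gp P P (k + l) * / gp P P k * / gp P P l).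
  { intros k l. rewrite <- qb_formula. field. auto. }
  assert (Hinv : forall N, (Cmod (/ gp P P N) <= / c)%R).
  { intros N. rewrite Cmod_inv by auto. apply Rinv_le_contravar; auto. }
  assert (Hqb : forall k l, (Cmod (qb P (k + l) k) <= B * / c * / c)%R).
  { intros k l. rewrite Hq, !Cmod_mult.
    repeat apply Rmult_le_compat; auto; try apply Cmod_ge_0. apply Rmult_le_pos; apply Cmod_ge_0. }
  (* When both lower entries grow the coefficient tends to f / (f f) = 1/f. The slack j allows for
     the lag of N - j behind N. *)
  assert (Hlim : forall phi psi : nat -> nat, forall j,
    (forall n, (phi n + j >= n)%nat) -> (forall n, (psi n + j >= n)%nat) ->
    cv (fun n => qb P (phi n + psi n) (phi n)) (/ f)).
  { intros phi psi j H1 H2.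
    apply cv_ext with (fun n => gp P P (phi n + psi n) * / gp P P (phi n) * / gp P P (psi n)).
    { intros n. now rewrite Hq. }
    replace (/ f) with (f * / f * / f) by (field; auto).
    assert (Hi : cv (fun n => / gp P P n) (/ f)). { apply cv_inv with c; auto. now apply gp_cv. }
    repeat apply cv_mult.
    - apply (cv_shift_back (gp P P) f (fun n => (phi n + psi n)%nat) j). intros n; specialize (H1 n); lia. now apply gp_cv.
    - apply (cv_shift_back (fun n => / gp P P n) (/ f) phi j); auto.
    - apply (cv_shift_back (fun n => / gp P P n) (/ f) psi j); auto. }
  set (t := jt P z).
  destruct (gterm_edom (P / 2) (z + iPI - P / 2) HP2) as [K HK]. fold (jt P z) in HK.
  assert (Hmain : cv (fun N => gp P (P - z) (S N) * gp P z N) (/ f * gs (P / 2) (z + iPI - P / 2))).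
  { eapply cv_ext; [intros n; symmetry; apply jtp_finite|].
    assert (HC : (0 <= B * / c * / c)%R).
    { eapply Rle_trans; [apply Cmod_ge_0|apply (Hqb O O)]. }
    assert (HK0 : (0 <= K)%R) by (eapply edom_nonneg; apply HK).
    apply (tannery (fun N j => qb P (S N + N) (S N + j) * jt P z (Z.of_nat j)
               + qb P (S N + N) (N - j) * jt P z (-1 - Z.of_nat j)%Z)
       (fun j => / f * zpair t j) (fun j => (B * / c * / c * (2 * K)) * exp (- INR j))%R _ S).
    - auto.
    - intros N k Hk. pose proof (Hqb (S N + k)%nat (N - k)%nat) as H1. pose proof (Hqb (N - k)%nat (S N + k)%nat) as H2.
      replace (S N + k + (N - k))%nat with (S N + N)%nat in H1 by lia.
      replace (N - k + (S N + k))%nat with (S N + N)%nat in H2 by lia.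
      assert (H3 := HK (Z.of_nat k)). assert (H4 := HK (-1 - Z.of_nat k)%Z). fold t in H3, H4.
      rewrite <- INR_IZR_INZ in H3. rewrite minus_IZR, <- INR_IZR_INZ in H4. pose proof (pos_INR k).
      rewrite Rabs_pos_eq in H3 by auto.
      assert (H5 : (exp (- Rabs (-1 - INR k)) <= exp (- INR k))%R) by (apply exp_le; rewrite Rabs_left by lra; lra).
      assert (H6 : (Cmod (t (-1 - Z.of_nat k)%Z) <= K * exp (- INR k))%R).
      { eapply Rle_trans; [apply H4|]. apply Rmult_le_compat_l; auto. }
      eapply Rle_trans; [apply Cmod_triangle|]. rewrite !Cmod_mult.
      apply Rle_trans with ((B * / c * / c) * (K * exp (- INR k)) + (B * / c * / c) * (K * exp (- INR k)))%R; [|lra].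
      apply Rplus_le_compat; apply Rmult_le_compat; auto; apply Cmod_ge_0.
    - apply summable_scal; [|apply summable_exp]. apply Rmult_le_pos; lra.
    - intros j. unfold zpair.
      replace (/ f * (t (Z.of_nat j) + t (-1 - Z.of_nat j)%Z))
        with (/ f * t (Z.of_nat j) + / f * t (-1 - Z.of_nat j)%Z) by ring.
      apply cv_plus; apply cv_mult; try apply cv_const.
      + apply cv_ext_loc with (fun N => qb P (S N + j + (N - j)) (S N + j)) j.
        { intros N HN. f_equal. lia. }
        apply (Hlim (fun N => (S N + j)%nat) (fun N => (N - j)%nat) j); intros; lia.
      + apply cv_ext_loc with (fun N => qb P (N - j + (S N + j)) (N - j)) j.
        { intros N HN. f_equal. lia. }
        apply (Hlim (fun N => (N - j)%nat) (fun N => (S N + j)%nat) j); intros; lia.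
    - eapply cv_ext; [intros n; symmetry; apply csum_scal|]. apply cv_scal.
      apply Zsum_cv. now apply gterm_edom. }
  assert (E : / f * gs (P / 2) (z + iPI - P / 2) = G P (P - z) * G P z).
  { eapply cv_unique; [apply Hmain|]. apply cv_mult; [|now apply gp_cv].
    apply (cv_subseq (gp P (P - z)) _ S). intros; lia. now apply gp_cv. }
  replace (gs (P / 2) (z + iPI - P / 2)) with (f * (/ f * gs (P / 2) (z + iPI - P / 2))) by (field; auto).
  rewrite E. ring.
Qed.

(** * Theta functions *)

(* With [p = e^P] and [x = e^z], [T P z] is the series [sum_n (-1)^n p^(n(n-1)/2) x^n];
   [T1 P z] and twice [T2 P z] are its first two derivatives in [z]. *)
Definition T (P z : C) : C := gs (P / 2) (z + iPI - P / 2).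
Definition T1 (P z : C) : C := gs1 (P / 2) (z + iPI - P / 2).
Definition T2 (P z : C) : C := gs2 (P / 2) (z + iPI - P / 2).
(* [sum_m p^(m^2) x^(2m)] and [sum_m p^(m^2+m) x^(2m+1)]. *)
Definition thE (P z : C) : C := gs P (2 * z).
Definition thO (P z : C) : C := cexp z * gs P (2 * z + P).

Lemma half_neg (P : C) : (fst P < 0)%R -> (fst (P / 2)%C < 0)%R.
Proof. intros. simpl. lra. Qed.

Lemma gs_shift_back (P z : C) : (fst P < 0)%R -> gs P (2 * z - P) = cexp z * thO P z.
Proof.
  intros HP. unfold thO. replace (2 * z + P) with ((2 * z - P) + 2 * P) by ring.
  rewrite gs_shift by auto. rewrite !Cmult_assoc, <- !Cexp_plus.
  replace (z + z + (- P - (2 * z - P))) with (0 : C) by ring. rewrite Cexp_0. ring.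
Qed.

(** In [gs_mult] with u, v the two arguments, u + v depends on b alone and u - v on a alone, so the
    variables separate; the minus sign of the minor is the e^[iPI] in the odd prefactor. *)
Lemma T_mult (P a b : C) : (fst P < 0)%R ->
  T P (b + a) * T P (b - a) = cexp b * (thE P a * thO P b - thO P a * thE P b).
Proof.
  intros HP. unfold T. rewrite gs_mult by now apply half_neg.
  replace (2 * (P / 2)) with P by field.
  replace (b + a + iPI - P / 2 + (b - a + iPI - P / 2)) with ((2 * b - P) + 2 * iPI) by field.
  replace (b + a + iPI - P / 2 - (b - a + iPI - P / 2)) with (2 * a) by ring.
  replace (2 * b - P + 2 * iPI + P) with (2 * b + 2 * iPI) by ring.
  replace (P / 2 + (b - a + iPI - P / 2)) with (b + - a + iPI) by ring.
  rewrite !gs_period, !gs_shift_back by auto. rewrite !Cexp_plus, Cexp_iPI, Cexp_opp.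
  fold (thE P a). fold (thE P b). field. apply Cexp_neq_0.
Qed.

Lemma T_shift (P z : C) : (fst P < 0)%R -> T P (z + P) = - cexp (- z) * T P z.
Proof.
  intros HP. unfold T. replace (z + P + iPI - P / 2) with ((z + iPI - P / 2) + 2 * (P / 2)) by field.
  rewrite gs_shift by now apply half_neg.
  replace (- (P / 2) - (z + iPI - P / 2)) with (- z + - iPI) by ring.
  rewrite Cexp_plus, (Cexp_opp iPI), Cexp_iPI. field.
Qed.

Lemma T_period (P z : C) : T P (z + 2 * iPI) = T P z.
Proof.
  unfold T. rewrite <- (gs_period _ (z + iPI - P / 2)). f_equal. ring.
Qed.

Lemma T_opp (P z : C) : (fst P < 0)%R -> T P (- z) = - cexp (- z) * T P z.
Proof.
  intros HP. rewrite <- T_shift by auto. unfold T.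
  rewrite <- (gs_reflect _ (- z + iPI - P / 2)) by now apply half_neg.
  rewrite <- gs_period. f_equal. field.
Qed.

Lemma T_reflect (P z : C) : (fst P < 0)%R -> T P (P - z) = T P z.
Proof.
  intros HP. replace (P - z) with (- z + P) by ring. rewrite T_shift, T_opp by auto.
  replace (- - z) with z by ring. rewrite Cexp_opp. field. apply Cexp_neq_0.
Qed.

Lemma T_tay (P z : C) : (fst P < 0)%R -> tay (fun h => T P (z + h)) (T P z) (T1 P z) (T2 P z).
Proof.
  intros HP. eapply tay_ext; [|apply gs_tay_lin; now apply half_neg].
  intros h. unfold T. f_equal. ring.
Qed.

Lemma T_tay_minus (P z : C) : (fst P < 0)%R -> tay (fun h => T P (z - h)) (T P z) (- T1 P z) (T2 P z).
Proof.
  intros HP. eapply tay_eq; [eapply tay_ext; [|apply (tay_dilate _ (-1) _ _ _ (T_tay P z HP))]|..]; try ring.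
  intros h. simpl. f_equal. ring.
Qed.

(* [- TS P z / (T P z)^2] is the logarithmic second derivative of [T P] at [z]. *)
Definition TS (P z : C) : C := T1 P z * T1 P z - 2 * T P z * T2 P z.

(** The symmetric product is even in h, and it is what [T_mult] evaluates; thus the logarithmic
    second derivative is reached without dividing by T. *)
Lemma T_sym_tay (P z : C) : (fst P < 0)%R ->
  tay (fun h => T P (z + h) * T P (z - h)) (T P z * T P z) 0 (- TS P z).
Proof.
  intros HP. eapply tay_eq; [apply tay_mult; [now apply T_tay|now apply T_tay_minus]|..]; unfold TS; ring.
Qed.

Lemma Cexp_tay : tay cexp 1 1 (/ 2).
Proof.
  exists 1%R, (8 * exp 1)%R. split. lra. split. pose proof (exp_pos 1). lra. intros h Hh.
  replace (cexp h - (1 + 1 * h + / 2 * (h * h))) with (cexp h - 1 - h - h * h / 2) by field.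
  eapply Rle_trans; [apply Cexp_taylor2|].
  replace (8 * exp 1 * Cmod h ^ 3)%R with (8 * Cmod h ^ 3 * exp 1)%R by ring.
  apply Rmult_le_compat_l. pose proof (pow_le (Cmod h) 3 (Cmod_ge_0 h)). lra. apply exp_le. lra.
Qed.

(** The higher coefficients can remain unknown: in [TS_diff] they enter only through a minor that is
    computed afterwards. *)
Lemma thE_tay (P : C) : (fst P < 0)%R -> exists e1 e2, tay (thE P) (thE P 0) e1 e2.
Proof.
  intros HP. do 2 eexists. eapply tay_eq; [|unfold thE; reflexivity|reflexivity|reflexivity].
  replace (2 * 0) with (0 : C) by ring.
  eapply tay_ext; [|apply (tay_dilate _ 2 _ _ _ (gs_tay_lin P 0 HP))].
  intros h. unfold thE. simpl. f_equal. ring.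
Qed.

Lemma thO_tay (P : C) : (fst P < 0)%R -> exists o1 o2, tay (thO P) (thO P 0) o1 o2.
Proof.
  intros HP. do 2 eexists.
  eapply tay_eq; [|reflexivity|reflexivity|reflexivity].
  replace (thO P 0) with (1 * gs P P).
  - eapply tay_ext; [|apply (tay_mult _ _ _ _ _ _ _ _ Cexp_tay (tay_dilate _ 2 _ _ _ (gs_tay_lin P P HP)))].
    intros h. unfold thO. simpl. do 2 f_equal. ring.
  - unfold thO. rewrite Cexp_0. do 2 f_equal. ring.
Qed.

Lemma T_0 (P : C) : (fst P < 0)%R -> T P 0 = 0.
Proof.
  intros HP. unfold T. rewrite jacobi_triple_product by auto. rewrite (G_head P 0) by auto. rewrite Cexp_0. ring.
Qed.

(* The analogue of [wp a - wp b = sigma (b + a) sigma (b - a) / (sigma a sigma b)^2],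
   cleared of denominators. *)
Lemma TS_diff (P a b : C) : (fst P < 0)%R ->
  TS P a * (T P b * T P b) - TS P b * (T P a * T P a)
  = T1 P 0 * T1 P 0 * cexp a * (T P (b + a) * T P (b - a)).
Proof.
  intros HP. destruct (thE_tay P HP) as (e1 & e2 & HE). destruct (thO_tay P HP) as (o1 & o2 & HO).
  set (e0 := thE P 0) in *. set (o0 := thO P 0) in *.
  (* Comparing two expansions of T(c+h) T(c-h) makes both T(c)^2 and TS(c) linear in the vector (thE
     c, thO c). The expression to be evaluated is therefore a product of two 2x2 determinants, one
     constant and one given by [T_mult]. *)
  assert (H : forall c, T P c * T P c = cexp c * (e0 * thO P c - o0 * thE P c)
                     /\ - TS P c = cexp c * (e2 * thO P c - o2 * thE P c)).
  { intros c.
    assert (Hc : tay (fun h => T P (c + h) * T P (c - h))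
      (cexp c * (thO P c * e0 + - thE P c * o0)) (cexp c * (thO P c * e1 + - thE P c * o1))
      (cexp c * (thO P c * e2 + - thE P c * o2))).
    { eapply tay_ext; [|apply tay_scal; apply tay_plus; apply tay_scal; [exact HE|exact HO]].
      intros h. simpl. rewrite T_mult by auto. ring. }
    destruct (tay_unique _ _ _ _ _ _ _ (T_sym_tay P c HP) Hc) as (H0 & _ & H2).
    rewrite H0, H2. split; ring. }
  (* The constant determinant is found at c = 0, where T vanishes and TS reduces to the square of
     the derivative. *)
  assert (K : T1 P 0 * T1 P 0 = o2 * e0 - e2 * o0).
  { destruct (H 0) as [_ H2]. unfold TS in H2. rewrite T_0, Cexp_0 in H2 by auto.
    fold e0 o0 in H2.
    replace (T1 P 0 * T1 P 0) with (- - (T1 P 0 * T1 P 0 - 2 * 0 * T2 P 0)) by ring. rewrite H2. ring. }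
  rewrite K, T_mult by auto.
  destruct (H a) as [Ha Ha']. destruct (H b) as [Hb Hb'].
  replace (TS P a) with (- (cexp a * (e2 * thO P a - o2 * thE P a))) by (rewrite <- Ha'; ring).
  replace (TS P b) with (- (cexp b * (e2 * thO P b - o2 * thE P b))) by (rewrite <- Hb'; ring).
  rewrite Ha, Hb. ring.
Qed.

(** * The derivative of [T] at its zero *)

Definition lip0 (f : C -> C) (c : C) : Prop :=
  exists d K : R, (0 < d)%R /\ (0 <= K)%R /\ forall h, (Cmod h < d)%R -> (Cmod (f h - c) <= K * Cmod h)%R.

Lemma lip0_const (c : C) : lip0 (fun _ => c) c.
Proof.
  exists 1%R, 0%R. repeat split; try lra. intros. replace (c - c) with (0 : C) by ring. rewrite Cmod_0. lra.
Qed.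

Lemma lip0_mult (f g : C -> C) (a b : C) : lip0 f a -> lip0 g b -> lip0 (fun h => f h * g h) (a * b).
Proof.
  intros (d & K & Hd & HK & H) (d' & K' & Hd' & HK' & H').
  pose proof (Cmod_ge_0 a) as Pa. pose proof (Cmod_ge_0 b) as Pb.
  exists (Rmin (Rmin d d') 1), (K * (Cmod b + K') + Cmod a * K')%R. split.
  { repeat apply Rmin_glb_lt; lra. }
  split. { apply Rplus_le_le_0_compat; apply Rmult_le_pos; lra. }
  intros h Hh. pose proof (Rmin_l (Rmin d d') 1). pose proof (Rmin_r (Rmin d d') 1).
  pose proof (Rmin_l d d'). pose proof (Rmin_r d d').
  specialize (H h ltac:(lra)). specialize (H' h ltac:(lra)). pose proof (Cmod_ge_0 h) as Ph.
  replace (f h * g h - a * b) with ((f h - a) * (b + (g h - b)) + a * (g h - b)) by ring.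
  eapply Rle_trans; [apply Cmod_triangle|]. rewrite !Cmod_mult.
  pose proof (Cmod_triangle b (g h - b)) as HT.
  assert (Cmod (b + (g h - b)) <= Cmod b + K')%R by nra.
  rewrite Rmult_plus_distr_r. apply Rplus_le_compat.
  - replace (K * (Cmod b + K') * Cmod h)%R with ((K * Cmod h) * (Cmod b + K'))%R by ring.
    apply Rmult_le_compat; auto; apply Cmod_ge_0.
  - rewrite Rmult_assoc. apply Rmult_le_compat_l; auto.
Qed.

(** A product rule at a zero of D: the cofactor H is only Lipschitz at 0, which is all that is known
    for the infinite products. *)
Lemma tay_div_limit (F D H : C -> C) (a1 a2 d1 d2 c : C) :
  tay F 0 a1 a2 -> tay D 0 d1 d2 -> (forall h, F h = D h * H h) -> lip0 H c -> a1 = d1 * c.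
Proof.
  intros (dF & KF & HdF & HKF & HF) (dD & KD & HdD & HKD & HD) E (dH & KH & HdH & HKH & HH).
  set (d := Rmin (Rmin dF dD) (Rmin dH 1)).
  assert (Hd : (0 < d)%R) by (repeat apply Rmin_glb_lt; lra).
  set (M := (KF + Cmod a2 + KD * (Cmod c + KH) + Cmod d2 * (Cmod c + KH) + Cmod d1 * KH)%R).
  assert (Hz : a1 - d1 * c = 0); [|replace a1 with ((a1 - d1 * c) + d1 * c) by ring; rewrite Hz; ring].
  apply (C_zero_of_small _ d M Hd). intros t Ht.
  assert (d <= Rmin dF dD)%R by apply Rmin_l. assert (d <= Rmin dH 1)%R by apply Rmin_r.
  pose proof (Rmin_l dF dD). pose proof (Rmin_r dF dD). pose proof (Rmin_l dH 1). pose proof (Rmin_r dH 1).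
  assert (Et : Cmod t = t) by (apply Cmod_t; lra).
  specialize (HF t). specialize (HD t). specialize (HH t). rewrite Et in *.
  specialize (HF ltac:(lra)). specialize (HD ltac:(lra)). specialize (HH ltac:(lra)).
  set (x := F t - (0 + a1 * t + a2 * (t * t))) in *. set (y := D t - (0 + d1 * t + d2 * (t * t))) in *.
  assert (Hh : (Cmod (H t) <= Cmod c + KH)%R).
  { replace (H t) with ((H t - c) + c) by ring. eapply Rle_trans; [apply Cmod_triangle|]. nra. }
  assert (K2 : t * (a1 - d1 * c) = (- x + - (a2 * (t * t))) + (y * H t + d2 * (t * t) * H t) + d1 * t * (H t - c)).
  { unfold x, y. rewrite E. ring. }
  apply Rmult_le_reg_l with t. lra. rewrite <- Et at 1. rewrite <- Cmod_mult, K2.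
  eapply Rle_trans; [apply Cmod_triangle|]. eapply Rle_trans; [apply Rplus_le_compat_r; apply Cmod_triangle|].
  eapply Rle_trans; [apply Rplus_le_compat_r; apply Rplus_le_compat; apply Cmod_triangle|].
  rewrite !Cmod_opp, !Cmod_mult, !Et.
  assert (t ^ 3 <= t * t)%R by (simpl; nra).
  assert (A1 : (KF * t ^ 3 <= KF * (t * t))%R) by (apply Rmult_le_compat_l; auto).
  assert (A2 : (Cmod y * Cmod (H t) <= KD * (t * t) * (Cmod c + KH))%R).
  { apply Rmult_le_compat; try apply Cmod_ge_0; auto. eapply Rle_trans; [apply HD|]. apply Rmult_le_compat_l; auto. }
  assert (A3 : (Cmod d2 * (t * t) * Cmod (H t) <= Cmod d2 * (t * t) * (Cmod c + KH))%R).
  { apply Rmult_le_compat_l; auto. apply Rmult_le_pos. apply Cmod_ge_0. nra. }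
  assert (A4 : (Cmod d1 * t * Cmod (H t - c) <= Cmod d1 * t * (KH * t))%R).
  { apply Rmult_le_compat_l; auto. apply Rmult_le_pos. apply Cmod_ge_0. lra. }
  unfold M. lra.
Qed.

Lemma Cexp_lip0 (k : C) : lip0 (fun s => cexp (k * s)) 1.
Proof.
  destruct (tay_dilate _ k _ _ _ Cexp_tay) as (d & K & Hd & HK & H).
  exists (Rmin d 1), (K + Cmod (k * 1) + Cmod (k * k * / 2))%R.
  pose proof (Cmod_ge_0 (k * 1)). pose proof (Cmod_ge_0 (k * k * / 2)).
  split. { apply Rmin_glb_lt; lra. } split. lra.
  intros h Hh. pose proof (Rmin_l d 1). pose proof (Rmin_r d 1). pose proof (Cmod_ge_0 h).
  specialize (H h ltac:(lra)). simpl in H.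
  replace (cexp (k * h) - 1) with ((cexp (k * h) - (1 + k * 1 * h + k * k * / 2 * (h * h))) + (k * 1 * h + k * k * / 2 * (h * h))) by ring.
  eapply Rle_trans; [apply Cmod_triangle|].
  pose proof (Cmod_triangle (k * 1 * h) (k * k * / 2 * (h * h))) as HT.
  rewrite (Cmod_mult (k * 1)), (Cmod_mult (k * k * / 2)), (Cmod_mult h) in HT.
  set (x := Cmod h) in *.
  assert (x * x <= x)%R by nra. assert (x ^ 3 <= x)%R by (simpl; nra).
  assert (K * x ^ 3 <= K * x)%R by (apply Rmult_le_compat_l; auto).
  assert (Cmod (k * k * / 2) * (x * x) <= Cmod (k * k * / 2) * x)%R by (apply Rmult_le_compat_l; auto).
  simpl in *. lra.
Qed.

Lemma G_lip0 (P k : C) : (fst P < 0)%R -> lip0 (fun s => G P (P + k * s)) (G P P).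
Proof.
  intros HP. destruct (G_lipschitz P HP) as (K & HK & H). destruct (Cexp_lip0 k) as (d & K' & Hd & HK' & H').
  exists (Rmin d (/ (K' + 1))), (K * K')%R. split.
  { apply Rmin_glb_lt; auto. apply Rinv_0_lt_compat; lra. }
  split. now apply Rmult_le_pos.
  intros h Hh. pose proof (Rmin_l d (/ (K' + 1))). pose proof (Rmin_r d (/ (K' + 1))).
  specialize (H' h ltac:(lra)). pose proof (Cmod_ge_0 h).
  assert ((K' + 1) * Cmod h <= 1)%R.
  { apply Rle_trans with ((K' + 1) * / (K' + 1))%R. apply Rmult_le_compat_l; lra. right; field; lra. }
  eapply Rle_trans; [apply H|].
  - replace (cexp (k * h)) with ((cexp (k * h) - 1) + 1) by ring. eapply Rle_trans; [apply Cmod_triangle|].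
    rewrite Cmod_1. lra.
  - rewrite Rmult_assoc. apply Rmult_le_compat_l; auto.
Qed.

Lemma T1_0 (P : C) : (fst P < 0)%R -> T1 P 0 = - (G P P * G P P * G P P).
Proof.
  intros HP.
  assert (HT : tay (fun h => T P (0 + h)) 0 (T1 P 0) (T2 P 0)).
  { eapply tay_eq; [apply T_tay; auto|..]; auto. now apply T_0. }
  assert (HD : tay (fun h => 1 - cexp h) 0 (-1) (- / 2)).
  { eapply tay_eq; [eapply tay_ext; [|apply tay_plus; [apply (tay_const 1)|apply (tay_scal _ (-1) _ _ _ Cexp_tay)]]|..]; try ring.
    intros h. simpl. ring. }
  rewrite (tay_div_limit _ _ (fun h => G P P * (G P (P + 1 * h) * G P (P + (-1) * h))) _ _ _ _
    (G P P * (G P P * G P P)) HT HD).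
  - ring.
  (* The triple product isolates the simple zero as the factor 1 - e^h; the three remaining products
     tend to G P P. *)
  - intros h. replace (0 + h) with h by ring. unfold T. rewrite jacobi_triple_product by auto.
    rewrite (G_head P h) by auto. replace (P + 1 * h) with (h + P) by ring.
    replace (P + (-1) * h) with (P - h) by ring. ring.
  - apply lip0_mult. apply lip0_const. apply lip0_mult; now apply G_lip0.
Qed.

Lemma T_G (P z : C) : (fst P < 0)%R -> T P z = G P P * G P z * G P (P - z).
Proof. intros HP. unfold T. now apply jacobi_triple_product. Qed.

(** [T_reflect] is a symmetry about P/2, so T is even around that point. *)
Lemma T1_mid (P : C) : (fst P < 0)%R -> T1 P (P / 2) = 0.
Proof.
  intros HP.
  assert (H : tay (fun h => T P (P / 2 + h)) (T P (P / 2)) (- T1 P (P / 2)) (T2 P (P / 2))).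
  { eapply tay_ext; [|now apply T_tay_minus]. intros h. simpl.
    rewrite <- T_reflect by auto. f_equal. field. }
  destruct (tay_unique _ _ _ _ _ _ _ (T_tay P (P / 2) HP) H) as (_ & E & _).
  replace (T1 P (P / 2)) with (/ 2 * (T1 P (P / 2) + T1 P (P / 2))) by field.
  rewrite E at 2. ring.
Qed.

Lemma neg_scal (k : R) (Q : C) : (0 < k)%R -> (fst Q < 0)%R -> (fst (k * Q)%C < 0)%R.
Proof. intros. simpl. nra. Qed.

(** * Level 6 *)

Lemma Cmult_cancel_r (x y b : C) : b <> 0 -> x * b = y * b -> x = y.
Proof.
  intros Hb E. replace x with (x * b * / b) by (field; auto). rewrite E. field. auto.
Qed.

Section Level6.
Variable Q : C.
Hypothesis HQ : (fst Q < 0)%R.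
Let f1 := G Q Q.
Let f2 := G (2 * Q) (2 * Q).
Let f3 := G (3 * Q) (3 * Q).
Let f6 := G (6 * Q) (6 * Q).

Let H2 : (fst (2 * Q)%C < 0)%R. Proof. apply neg_scal; lra. Qed.
Let H3 : (fst (3 * Q)%C < 0)%R. Proof. apply neg_scal; lra. Qed.
Let H6 : (fst (6 * Q)%C < 0)%R. Proof. apply neg_scal; lra. Qed.

Lemma f1_neq_0 : f1 <> 0. Proof. now apply G_neq_0. Qed.

Lemma f2_neq_0 : f2 <> 0. Proof. now apply G_neq_0. Qed.

Lemma f3_neq_0 : f3 <> 0. Proof. now apply G_neq_0. Qed.

Lemma f6_neq_0 : f6 <> 0. Proof. now apply G_neq_0. Qed.

Hint Resolve f1_neq_0 f2_neq_0 f3_neq_0 f6_neq_0 : core.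

(** * Theta values at multiples of [Q] as quotients of [f1], [f2], [f3], [f6] *)

Lemma f1_mod2 : f1 = G (2 * Q) Q * f2.
Proof.
  unfold f1. rewrite G_dissect2 by auto. unfold f2. do 2 f_equal. ring.
Qed.

Lemma f1_mod3 : f1 = G (3 * Q) Q * G (3 * Q) (2 * Q) * f3.
Proof.
  unfold f1. rewrite G_dissect3 by auto. unfold f3.
  replace (Q + Q) with (2 * Q) by ring. replace (Q + 2 * Q) with (3 * Q) by ring. reflexivity.
Qed.

Lemma f2_mod3 : f2 = G (6 * Q) (2 * Q) * G (6 * Q) (4 * Q) * f6.
Proof.
  unfold f2. rewrite G_dissect3 by auto. unfold f6.
  replace (3 * (2 * Q)) with (6 * Q) by ring. replace (2 * Q + 2 * Q) with (4 * Q) by ring.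
  replace (2 * Q + 2 * (2 * Q)) with (6 * Q) by ring. reflexivity.
Qed.

Lemma f3_mod2 : f3 = G (6 * Q) (3 * Q) * f6.
Proof.
  unfold f3. rewrite G_dissect2 by auto. unfold f6.
  replace (2 * (3 * Q)) with (6 * Q) by ring. replace (3 * Q + 3 * Q) with (6 * Q) by ring. reflexivity.
Qed.

Lemma f1_mod6 : f1 = G (6 * Q) Q * G (6 * Q) (3 * Q) * G (6 * Q) (5 * Q) * f2.
Proof.
  rewrite f1_mod2, G_dissect3 by auto.
  replace (3 * (2 * Q)) with (6 * Q) by ring. replace (Q + 2 * Q) with (3 * Q) by ring.
  replace (Q + 2 * (2 * Q)) with (5 * Q) by ring. reflexivity.
Qed.

Lemma T2_1 : T (2 * Q) Q = f1 * f1 / f2.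
Proof.
  rewrite T_G, f1_mod2 by auto. fold f2. replace (2 * Q - Q) with Q by ring. field. auto.
Qed.

Lemma T6_1 : T (6 * Q) Q = f1 * f6 * f6 / (f2 * f3).
Proof.
  rewrite T_G by auto. fold f6. replace (6 * Q - Q) with (5 * Q) by ring.
  apply Cmult_cancel_r with (f2 * f3); [now apply Cmult_neq_0|].
  replace (f1 * f6 * f6 / (f2 * f3) * (f2 * f3)) with (f1 * f6 * f6) by (field; auto).
  rewrite f1_mod6, f3_mod2. ring.
Qed.

Lemma T6_2 : T (6 * Q) (2 * Q) = f2.
Proof.
  rewrite T_G, f2_mod3 by auto. fold f6. replace (6 * Q - 2 * Q) with (4 * Q) by ring. ring.
Qed.

Lemma T6_3 : T (6 * Q) (3 * Q) = f3 * f3 / f6.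
Proof.
  rewrite T_G, f3_mod2 by auto. fold f6. replace (6 * Q - 3 * Q) with (3 * Q) by ring. field. auto.
Qed.

Lemma T6_4 : T (6 * Q) (4 * Q) = f2.
Proof. rewrite <- T6_2, <- (T_reflect _ (2 * Q)) by auto. f_equal. ring. Qed.

Lemma T3_1 : T (3 * Q) Q = f1.
Proof.
  rewrite T_G, f1_mod3 by auto. fold f3. replace (3 * Q - Q) with (2 * Q) by ring. ring.
Qed.

(** Multiplying by f1 pairs each twisted factor with its untwisted one, and [G_square] turns the
    pairs into the factors of f2 modulo 6. *)
Lemma T3_1i : T (3 * Q) (Q + iPI) = f3 * f3 * f2 / (f1 * f6).
Proof.
  rewrite T_G by auto. fold f3.
  replace (3 * Q - (Q + iPI)) with (2 * Q - iPI) by ring.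
  rewrite <- (G_period _ (2 * Q - iPI)) by auto. replace (2 * Q - iPI + 2 * iPI) with (2 * Q + iPI) by ring.
  pose proof (G_square (3 * Q) Q H3) as E1. pose proof (G_square (3 * Q) (2 * Q) H3) as E2.
  replace (2 * (3 * Q)) with (6 * Q) in E1, E2 by ring. replace (2 * (2 * Q)) with (4 * Q) in E2 by ring.
  apply Cmult_cancel_r with (f1 * f6); [now apply Cmult_neq_0|].
  replace (f3 * f3 * f2 / (f1 * f6) * (f1 * f6)) with (f3 * f3 * f2) by (field; auto).
  rewrite f1_mod3, f2_mod3, <- E1, <- E2. ring.
Qed.

(** The factor 2 is the leading factor 1 - e^[iPI] of the product. *)
Lemma T3_0i : T (3 * Q) iPI = 2 * f6 * f6 / f3.
Proof.
  rewrite T_G by auto. fold f3. rewrite (G_head _ iPI) by auto. rewrite Cexp_iPI.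
  rewrite <- (G_period _ (3 * Q - iPI)) by auto.
  replace (3 * Q - iPI + 2 * iPI) with (3 * Q + iPI) by ring. replace (iPI + 3 * Q) with (3 * Q + iPI) by ring.
  pose proof (G_square (3 * Q) (3 * Q) H3) as E. replace (2 * (3 * Q)) with (6 * Q) in E by ring.
  fold f3 f6 in E. rewrite <- E. field. auto.
Qed.

(* Pluecker's relation for the points [iPI], [Q], [Q + iPI] and [0] on the curve of nome [q^3]. *)
Lemma quartic_relation :
  T (3 * Q) (Q + iPI) ^ 4 - T (3 * Q) Q ^ 4 = cexp Q * T (3 * Q) iPI ^ 3 * T (3 * Q) (Q + iPI).
Proof.
  set (P := 3 * Q) in *.
  set (br := fun a b => thE P a * thO P b - thO P a * thE P b).
  assert (Hbr : forall a b, br a b = cexp (- b) * (T P (b + a) * T P (b - a))).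
  { intros a b. rewrite T_mult, Cexp_opp by auto. unfold br. field. apply Cexp_neq_0. }
  assert (Pl : br iPI Q * br (Q + iPI) 0 + br Q (Q + iPI) * br iPI 0 + br (Q + iPI) iPI * br Q 0 = 0)
    by (unfold br; ring).
  assert (Em : forall z, T P (z - iPI) = T P (z + iPI)).
  { intros z. rewrite <- T_period. f_equal. ring. }
  assert (B1 : br iPI Q = cexp (- Q) * (T P (Q + iPI) * T P (Q + iPI))).
  { rewrite Hbr, Em. reflexivity. }
  assert (B2 : forall c, br c 0 = - cexp (- c) * (T P c * T P c)).
  { intros c. rewrite Hbr. replace (0 + c) with c by ring. replace (0 - c) with (- c) by ring.
    rewrite T_opp by auto. replace (- 0) with (0 : C) by ring. rewrite Cexp_0. ring. }
  (* The choice p = q^3 matters here: z -> P - z sends 2Q + iPI to Q - iPI, so the sum of the two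
     points produces no new theta value. *)
  assert (B3 : br Q (Q + iPI) = - cexp (- Q) * (T P (Q + iPI) * T P iPI)).
  { rewrite Hbr. replace (Q + iPI - Q) with iPI by ring.
    rewrite <- (T_reflect P (Q + iPI + Q)) by auto.
    replace (P - (Q + iPI + Q)) with (Q - iPI) by (unfold P; ring). rewrite Em.
    replace (- (Q + iPI)) with (- Q + - iPI) by ring. rewrite Cexp_plus, (Cexp_opp iPI), Cexp_iPI. field. }
  assert (B4 : br (Q + iPI) iPI = cexp (- Q) * (T P Q * T P Q)).
  { rewrite Hbr. replace (iPI + (Q + iPI)) with (Q + 2 * iPI) by ring. rewrite T_period.
    replace (iPI - (Q + iPI)) with (- Q) by ring. rewrite T_opp, (Cexp_opp iPI), Cexp_iPI by auto. field. }
  rewrite B1, !B2, B3, B4 in Pl.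
  replace (- (Q + iPI)) with (- Q + - iPI) in Pl by ring.
  rewrite Cexp_plus, (Cexp_opp iPI), Cexp_iPI, Cexp_opp in Pl.
  pose proof (Cexp_neq_0 Q) as Hq. set (q := cexp Q) in *.
  set (x := T P (Q + iPI)) in *. set (y := T P Q) in *. set (z := T P iPI) in *.
  assert (Pl' : x ^ 4 - y ^ 4 - q * z ^ 3 * x = 0).
  { transitivity (q * q * (/ q * (x * x) * (- (/ q * / - (1)) * (x * x)) + - / q * (x * z) * (- / - (1) * (z * z)) + / q * (y * y) * (- / q * (y * y)))).
    - field. auto.
    - rewrite Pl. ring. }
  replace (x ^ 4 - y ^ 4) with (x ^ 4 - y ^ 4 - q * z ^ 3 * x + q * z ^ 3 * x) by ring.
  rewrite Pl'. ring.
Qed.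

(** Both z-dependent products of nome q^2 are split into three of nome q^6; those of 2Q - z belong
    to z + 4Q, z + 2Q and z in this order. *)
Lemma T2_split (z : C) :
  T (2 * Q) z = f2 / (f6 * f6 * f6) * (T (6 * Q) z * T (6 * Q) (z + 2 * Q) * T (6 * Q) (z + 4 * Q)).
Proof.
  rewrite !T_G by auto. fold f2 f6. rewrite (G_dissect3 (2 * Q) z), (G_dissect3 (2 * Q) (2 * Q - z)) by auto.
  replace (3 * (2 * Q)) with (6 * Q) by ring. replace (z + 2 * (2 * Q)) with (z + 4 * Q) by ring.
  replace (2 * Q - z + 2 * Q) with (6 * Q - (z + 2 * Q)) by ring.
  replace (2 * Q - z + 2 * (2 * Q)) with (6 * Q - z) by ring.
  replace (2 * Q - z) with (6 * Q - (z + 4 * Q)) by ring. field. auto.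
Qed.

(** At z = Q the three translates are Q, 3Q, 5Q, and 5Q reflects to Q. The symmetric product is thus
    a constant times the square of the one at Q times the one at 3Q: S(Q) counts twice and S(3Q)
    once. *)
Lemma TS_split :
  TS (2 * Q) Q = (f2 / (f6 * f6 * f6)) ^ 2 *
    (2 * T (6 * Q) Q ^ 2 * TS (6 * Q) Q * T (6 * Q) (3 * Q) ^ 2 + T (6 * Q) Q ^ 4 * TS (6 * Q) (3 * Q)).
Proof.
  set (k := f2 / (f6 * f6 * f6)).
  pose proof (T_sym_tay (6 * Q) Q H6) as A. pose proof (T_sym_tay (6 * Q) (3 * Q) H6) as B.
  pose proof (tay_scal _ (k * k) _ _ _ (tay_mult _ _ _ _ _ _ _ _ (tay_mult _ _ _ _ _ _ _ _ A A) B)) as H.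
  apply (tay_ext _ (fun h => T (2 * Q) (Q + h) * T (2 * Q) (Q - h))) in H.
  - destruct (tay_unique _ _ _ _ _ _ _ (T_sym_tay (2 * Q) Q H2) H) as (_ & _ & E).
    replace (TS (2 * Q) Q) with (- - TS (2 * Q) Q) by ring. rewrite E. ring.
  - intros h. simpl. rewrite !T2_split. fold k.
    replace (Q + h + 2 * Q) with (3 * Q + h) by ring. replace (Q - h + 2 * Q) with (3 * Q - h) by ring.
    rewrite <- (T_reflect _ (Q + h + 4 * Q)), <- (T_reflect _ (Q - h + 4 * Q)) by auto.
    replace (6 * Q - (Q + h + 4 * Q)) with (Q - h) by ring. replace (6 * Q - (Q - h + 4 * Q)) with (Q + h) by ring.
    ring.
Qed.

(** For a = Q and b = 3Q the points b + a and b - a are reflections of each other, both with theta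
    value f2. *)
Lemma TS_diff_level6 :
  TS (6 * Q) Q * T (6 * Q) (3 * Q) ^ 2 - TS (6 * Q) (3 * Q) * T (6 * Q) Q ^ 2 = f6 ^ 6 * cexp Q * f2 ^ 2.
Proof.
  pose proof (TS_diff (6 * Q) Q (3 * Q) H6) as E.
  replace (3 * Q + Q) with (4 * Q) in E by ring. replace (3 * Q - Q) with (2 * Q) in E by ring.
  rewrite T6_4, T6_2, T1_0 in E by auto. fold f6 in E.
  transitivity (TS (6 * Q) Q * (T (6 * Q) (3 * Q) * T (6 * Q) (3 * Q)) - TS (6 * Q) (3 * Q) * (T (6 * Q) Q * T (6 * Q) Q)).
  ring. rewrite E. ring.
Qed.

(** At the symmetric point only T2 survives in S, and by the heat equation T2 is half a
    q-derivative. This links S to phi and chi. *)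
Lemma TS_mid (P : C) : (fst P < 0)%R -> TS P (P / 2) = - 2 * T P (P / 2) * T2 P (P / 2).
Proof. intros HP. unfold TS. rewrite T1_mid by auto. ring. Qed.

(* [phi h] and [chi h] are [sum_n (-1)^n q^(n^2)] at [e^h q] and at [(e^h q)^3]. *)
Definition phi (h : C) : C := gs (Q + h) iPI.
Definition chi (h : C) : C := gs (3 * (Q + h)) iPI.

(** At z = P/2 the linear exponent of the series for T reduces to [iPI], that is, to the signs; so
    phi(0) and chi(0) are T at the symmetric points for P = 2Q and P = 6Q. *)
Lemma phi_tay : exists a2, tay phi (f1 * f1 / f2) (2 * T2 (2 * Q) Q) a2.
Proof.
  eexists. eapply tay_eq; [apply (gs_tay_quad Q iPI HQ)|..]; [| |reflexivity].
  - rewrite <- T2_1. unfold T. f_equal; field.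
  - unfold T2. do 2 f_equal; field.
Qed.

Lemma chi_tay : exists a2, tay chi (f3 * f3 / f6) (3 * (2 * T2 (6 * Q) (3 * Q))) a2.
Proof.
  eexists. eapply tay_eq; [eapply tay_ext; [|apply (tay_dilate _ 3 _ _ _ (gs_tay_quad (3 * Q) iPI H3))]|..]; [| | |reflexivity].
  - intros h. unfold chi. simpl. f_equal. ring.
  - rewrite <- T6_3. unfold T. f_equal; field.
  - unfold T2. do 3 f_equal; field.
Qed.

Lemma level6_tay : exists a2,
  tay (fun h => (chi h * / phi h) ^ 4)
    ((f2 * f3 ^ 2 / (f1 ^ 2 * f6)) ^ 4)
    ((f2 ^ 7 * f3 ^ 7) / (f1 ^ 5 * f6 ^ 5) * ((f2 * f3 ^ 2 / (f1 ^ 2 * f6)) ^ 4 - 1)) a2.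
Proof.
  destruct phi_tay as [p2 Hp]. destruct chi_tay as [c2 Hc].
  assert (Hp0 : f1 * f1 / f2 <> 0).
  { intros E. apply (Cmult_neq_0 f1 f1); auto.
    replace (f1 * f1) with (f1 * f1 / f2 * f2) by (field; auto). rewrite E. ring. }
  pose proof (tay_mult _ _ _ _ _ _ _ _ Hc (tay_inv _ _ _ _ Hp0 Hp)) as Hu.
  pose proof (tay_mult _ _ _ _ _ _ _ _ Hu Hu) as Hu2.
  pose proof (tay_mult _ _ _ _ _ _ _ _ Hu2 Hu2) as Hu4.
  eexists. eapply tay_eq; [eapply tay_ext; [|exact Hu4]|..]; [| | |reflexivity].
  - intros h. simpl. ring.
  - field. repeat split; auto.
  - pose proof quartic_relation as EB. rewrite T3_1, T3_1i, T3_0i in EB.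
    pose proof TS_diff_level6 as EA. pose proof TS_split as ES.
    assert (M2 : TS (2 * Q) Q = - 2 * T (2 * Q) Q * T2 (2 * Q) Q).
    { pose proof (TS_mid (2 * Q) H2) as M. replace (2 * Q / 2) with Q in M by field. exact M. }
    assert (M6 : TS (6 * Q) (3 * Q) = - 2 * T (6 * Q) (3 * Q) * T2 (6 * Q) (3 * Q)).
    { pose proof (TS_mid (6 * Q) H6) as M. replace (6 * Q / 2) with (3 * Q) in M by field. exact M. }
    rewrite M2, M6, T2_1, T6_1, T6_3 in ES. rewrite M6, T6_1, T6_3 in EA.
    pose proof f1_neq_0. pose proof f2_neq_0. pose proof f3_neq_0. pose proof f6_neq_0.
    set (g2 := T2 (2 * Q) Q) in *. set (g6 := T2 (6 * Q) (3 * Q)) in *. set (s := TS (6 * Q) Q) in *.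
    set (q := cexp Q) in *. clearbody g2 g6 s q f1 f2 f3 f6.
    (* [EA] determines s and then [ES] determines g2. The unknown g6 cancels in the end, as 4 (2
       S(Q) + S(3Q) - 3 S(3Q)) has the form 8 (S(Q) - S(3Q)). *)
    assert (Es : s = (f6 ^ 6 * q * f2 ^ 2 - 2 * (f3 * f3 / f6) * g6 * (f1 * f6 * f6 / (f2 * f3)) ^ 2) / (f3 * f3 / f6) ^ 2).
    { rewrite <- EA. field. repeat split; auto. }
    assert (Eg : g2 = - (/ 2) * (f2 / (f1 * f1)) * (- 2 * (f1 * f1 / f2) * g2)) by (field; auto).
    rewrite ES, Es in Eg.
    (* W is the fourth power of T(Q + iPI) / T(Q) for nome q^3, so W - 1 is the quartic relation
       divided by f1^4. *)
    assert (EW : (f2 * f3 ^ 2 / (f1 ^ 2 * f6)) ^ 4 - 1 = 8 * q * f2 * f6 ^ 5 / (f1 ^ 5 * f3)).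
    { transitivity (((f3 * f3 * f2 / (f1 * f6)) ^ 4 - f1 ^ 4) / f1 ^ 4).
      field; repeat split; auto. rewrite EB. field. repeat split; auto. }
    (* Both sides reduce to 8 q f2^8 f3^6 / f1^10. *)
    rewrite EW, Eg. field. repeat split; auto.
Qed.

End Level6.

(** * The eta quotients of the statement *)

Lemma Cpow_Defs (z : C) (n : nat) : Defs.Cpow z n = (z ^ n : C).
Proof. induction n as [|n IH]; [reflexivity|]. rewrite Cpow_S, <- IH. reflexivity. Qed.

Lemma W_C (tau : C) :
  W tau = (eta (Cscale 2 tau) * eta (Cscale 3 tau) ^ 2 / (eta tau ^ 2 * eta (Cscale 6 tau)) : C) ^ 4.
Proof.
  unfold W. generalize (eta (Cscale 2 tau)) (eta (Cscale 3 tau)) (eta tau) (eta (Cscale 6 tau)).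
  intros a b c d. rewrite Cpow_Defs, (Cpow_Defs b), (Cpow_Defs c). reflexivity.
Qed.

Lemma dW_C (x a b c d w : C) :
  Cmul x (Cmul (Defs.Cdiv (Cmul (Defs.Cpow a 7) (Defs.Cpow b 7)) (Cmul (Defs.Cpow c 5) (Defs.Cpow d 5)))
    (Csub w Cone)) = (x * (a ^ 7 * b ^ 7 / (c ^ 5 * d ^ 5) * (w - 1)) : C).
Proof. rewrite (Cpow_Defs a), (Cpow_Defs b), (Cpow_Defs c), (Cpow_Defs d). reflexivity. Qed.

Definition logq (tau : C) : C := 2 * iPI * tau.

Lemma logq_neg (tau : C) : (Cim tau > 0)%R -> (fst (logq tau) < 0)%R.
Proof.
  intros H. unfold Cim in H. pose proof PI_RGT_0. unfold logq, iPI. simpl. nra.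
Qed.

Lemma logq_Cscale (k : R) (tau : C) : logq (Cscale k tau) = k * logq tau.
Proof. unfold logq, Cscale, iPI. apply injective_projections; simpl; ring. Qed.

Lemma qexp_logq (tau : C) : qexp tau = cexp (logq tau).
Proof.
  unfold qexp, cexp. f_equal. unfold logq, iPI. apply injective_projections; simpl; ring.
Qed.

Lemma Cpow_cexp (z : C) (n : nat) : Defs.Cpow (cexp z) n = cexp (INR n * z).
Proof.
  induction n as [|n IH].
  - simpl. replace (0 * z) with (0 : C) by ring. now rewrite Cexp_0.
  - rewrite RtoC_INR_S. replace ((INR n + 1) * z) with (z + INR n * z) by ring.
    rewrite Cexp_plus, <- IH. reflexivity.
Qed.

Lemma qpoch_partial_gp (tau : C) (N : nat) :
  qpoch_partial (qexp tau) N = gp (logq tau) (logq tau) N.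
Proof.
  induction N as [|N IH]; auto. rewrite gp_self_S, <- IH, <- Cpow_cexp, <- qexp_logq. reflexivity.
Qed.

Lemma qpoch_inf_G (tau : C) : (Cim tau > 0)%R -> qpoch_inf tau = G (logq tau) (logq tau).
Proof.
  intros H.
  assert (Hc : cv (qpoch_partial (qexp tau)) (G (logq tau) (logq tau))).
  { apply cv_ext with (gp (logq tau) (logq tau)). intros; symmetry; apply qpoch_partial_gp.
    apply gp_cv. now apply logq_neg. }
  apply cv_unique with (qpoch_partial (qexp tau)); auto.
  unfold qpoch_inf, Clim. apply (epsilon_spec (inhabits Czero) (fun l => Cseq_cv (qpoch_partial (qexp tau)) l)).
  eexists. exact Hc.
Qed.

Lemma eta_G (k : R) (tau : C) : (0 < k)%R -> (Cim tau > 0)%R ->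
  eta (Cscale k tau) = cexp (k * (logq tau / 24)) * G (k * logq tau) (k * logq tau).
Proof.
  intros Hk H. unfold eta. rewrite qpoch_inf_G, logq_Cscale.
  - change Cmul with Cmult. f_equal. unfold cexp. f_equal.
    unfold logq, Cscale, iPI. apply injective_projections; simpl; field.
  - unfold Cim, Cscale in *. simpl. nra.
Qed.

Lemma eta_G_1 (tau : C) : (Cim tau > 0)%R ->
  eta tau = cexp (logq tau / 24) * G (logq tau) (logq tau).
Proof.
  intros H. pose proof (eta_G 1 tau ltac:(lra) H) as E.
  replace (1 * (logq tau / 24)) with (logq tau / 24) in E by ring.
  replace (1 * logq tau) with (logq tau) in E by ring. rewrite <- E. f_equal.
  unfold Cscale. apply injective_projections; simpl; ring.
Qed.

Lemma cexp_nat_mult (k : nat) (z : C) : cexp (INR k * z) = cexp z ^ k.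
Proof. rewrite <- Cpow_cexp. reflexivity. Qed.

Section EtaQuotients.
Variable tau : C.
Hypothesis Htau : (Cim tau > 0)%R.
Let Q := logq tau.
Let x := cexp (Q / 24).

Lemma eta_2 : eta (Cscale 2 tau) = x ^ 2 * G (2 * Q) (2 * Q).
Proof.
  rewrite eta_G by (auto; lra). fold Q. unfold x. rewrite <- cexp_nat_mult. replace (INR 2) with 2%R by (simpl; ring). reflexivity.
Qed.

Lemma eta_3 : eta (Cscale 3 tau) = x ^ 3 * G (3 * Q) (3 * Q).
Proof.
  rewrite eta_G by (auto; lra). fold Q. unfold x. rewrite <- cexp_nat_mult. replace (INR 3) with 3%R by (simpl; ring). reflexivity.
Qed.

Lemma eta_6 : eta (Cscale 6 tau) = x ^ 6 * G (6 * Q) (6 * Q).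
Proof.
  rewrite eta_G by (auto; lra). fold Q. unfold x. rewrite <- cexp_nat_mult. replace (INR 6) with 6%R by (simpl; ring). reflexivity.
Qed.

(** The powers of q^(1/24) cancel because 2 + 2·3 = 2·1 + 6. *)
Lemma W_G : W tau = (G (2 * Q) (2 * Q) * G (3 * Q) (3 * Q) ^ 2 / (G Q Q ^ 2 * G (6 * Q) (6 * Q))) ^ 4.
Proof.
  pose proof (logq_neg tau Htau) as HQ. fold Q in HQ.
  pose proof (f1_neq_0 Q HQ). pose proof (f2_neq_0 Q HQ). pose proof (f3_neq_0 Q HQ). pose proof (f6_neq_0 Q HQ).
  pose proof (Cexp_neq_0 (Q / 24)).
  rewrite W_C, eta_2, eta_3, eta_6, eta_G_1 by auto. fold Q x.
  f_equal. field. auto.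
Qed.

(** Here the powers of q^(1/24) cancel because 7 (2 + 3) = 5 (1 + 6). *)
Lemma eta_quotient_G :
  (eta (Cscale 2 tau) ^ 7 * eta (Cscale 3 tau) ^ 7) / (eta tau ^ 5 * eta (Cscale 6 tau) ^ 5)
  = (G (2 * Q) (2 * Q) ^ 7 * G (3 * Q) (3 * Q) ^ 7) / (G Q Q ^ 5 * G (6 * Q) (6 * Q) ^ 5).
Proof.
  pose proof (logq_neg tau Htau) as HQ. fold Q in HQ.
  pose proof (f1_neq_0 Q HQ). pose proof (f2_neq_0 Q HQ). pose proof (f3_neq_0 Q HQ). pose proof (f6_neq_0 Q HQ).
  pose proof (Cexp_neq_0 (Q / 24)).
  rewrite eta_2, eta_3, eta_6, eta_G_1 by auto. fold Q x. field. auto.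
Qed.

End EtaQuotients.

(** * From the expansion in log q to the complex derivative in tau *)

Lemma tay_at_0 (f : C -> C) (a0 a1 a2 : C) : tay f a0 a1 a2 -> f 0 = a0.
Proof.
  intros (d & K & Hd & HK & H). specialize (H 0). rewrite Cmod_0 in H. specialize (H Hd).
  apply Cmod_small_eq. intros eps He.
  replace (f 0 - a0) with (f 0 - (a0 + a1 * 0 + a2 * (0 * 0))) by ring.
  replace (K * 0 ^ 3)%R with 0%R in H by ring. lra.
Qed.

(** Read off from the constant coefficient of [level6_tay] at each tau separately, which then allows
    tau to move. *)
Lemma W_phi_chi (tau : C) : (Cim tau > 0)%R ->
  W tau = (chi (logq tau) 0 * / phi (logq tau) 0) ^ 4.
Proof.
  intros H. destruct (level6_tay _ (logq_neg tau H)) as [a2 Ha].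
  rewrite W_G by auto. symmetry. exact (tay_at_0 _ _ _ _ Ha).
Qed.

Lemma tay_derivable (f : C -> C) (z a0 a1 a2 : C) (r : R) (g : C -> C) : (0 < r)%R ->
  (forall h, (Cmod h < r)%R -> f (z + h) = g h) -> tay g a0 a1 a2 -> C_derivable_lim f z a1.
Proof.
  intros Hr E Hg. pose proof (tay_at_0 _ _ _ _ Hg) as E0.
  assert (Ez : f z = a0).
  { rewrite <- E0, <- E. f_equal. ring. now rewrite Cmod_0. }
  destruct Hg as (d & K & Hd & HK & H).
  intros eps He. pose proof (Cmod_ge_0 a2).
  set (M := (K + Cmod a2 + 1)%R). assert (HM : (0 < M)%R) by (unfold M; lra).
  exists (Rmin (Rmin d r) (Rmin 1 (eps / M))). split.
  { repeat apply Rmin_glb_lt; try lra. apply Rdiv_lt_0_compat; lra. }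
  intros h Hh0 Hh. change Cnorm with Cmod in *.
  change (Cmod ((f (z + h) - f z) / h - a1)%C < eps)%R.
  pose proof (Rmin_l (Rmin d r) (Rmin 1 (eps / M))). pose proof (Rmin_r (Rmin d r) (Rmin 1 (eps / M))).
  pose proof (Rmin_l d r). pose proof (Rmin_r d r). pose proof (Rmin_l 1 (eps / M)). pose proof (Rmin_r 1 (eps / M)).
  assert (Hx : (0 < Cmod h)%R) by now apply Cmod_gt_0.
  specialize (H h ltac:(lra)). rewrite E, Ez by lra.
  replace ((g h - a0) / h - a1) with ((g h - (a0 + a1 * h + a2 * (h * h))) / h + a2 * h) by (field; auto).
  eapply Rle_lt_trans; [apply Cmod_triangle|]. rewrite Cmod_div, Cmod_mult by auto.
  assert (A : (Cmod (g h - (a0 + a1 * h + a2 * (h * h))) / Cmod h <= K * Cmod h)%R).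
  { apply Rmult_le_reg_r with (Cmod h); auto. unfold Rdiv. rewrite Rmult_assoc, Rinv_l, Rmult_1_r by lra.
    eapply Rle_trans; [apply H|]. simpl.
    assert (Cmod h * Cmod h <= Cmod h)%R by nra.
    replace (K * (Cmod h * (Cmod h * (Cmod h * 1))))%R with ((K * Cmod h) * (Cmod h * Cmod h))%R by ring.
    apply Rmult_le_compat_l; auto. apply Rmult_le_pos; lra. }
  apply Rle_lt_trans with (M * Cmod h)%R. unfold M; nra.
  replace eps with (M * (eps / M))%R by (field; lra). apply Rmult_lt_compat_l; lra.
Qed.

Open Scope R_scope.

Theorem mainTheorem10 (tau : Cx) (Htau : Cim tau > 0) :
  C_derivable_lim W tau
    (Cmul (Cmul (RtoC (2 * PI)) Ci)
      (Cmul (Cdiv (Cmul (Cpow (eta (Cscale 2 tau)) 7) (Cpow (eta (Cscale 3 tau)) 7))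
                  (Cmul (Cpow (eta tau) 5) (Cpow (eta (Cscale 6 tau)) 5)))
            (Csub (W tau) Cone))).
Proof.
  pose proof (logq_neg tau Htau) as HQ.
  destruct (level6_tay _ HQ) as [a2 Ha].
  (* The chain rule: an increment h of tau moves log q by 2 pi i h, so dilation turns q d/dq into
     d/dtau. *)
  pose proof (tay_dilate _ (2 * iPI) _ _ _ Ha) as Hd. rewrite <- W_G, <- eta_quotient_G in Hd by auto.
  match goal with |- C_derivable_lim _ _ ?L => match type of Hd with tay _ _ ?L' _ => replace L with L' end end.
  (* The radius is Im tau, so that tau + h stays in the upper half-plane. *)
  - eapply tay_derivable; [exact Htau| |exact Hd]. intros h Hh.
    assert (Hi : (Cim (tau + h)%C > 0)%R).
    { unfold Cim in *. simpl. pose proof (Rmax_Cmod h). pose proof (Rmax_r (Rabs (fst h)) (Rabs (snd h))).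
      pose proof (Rle_abs (- snd h)). rewrite Rabs_Ropp in *. lra. }
    rewrite W_phi_chi by auto.
    (* The series based at tau + h are those based at tau with increment 2 pi i h, since log q is
       linear in tau. *)
    replace (chi (logq (tau + h)%C) 0) with (chi (logq tau) (2 * iPI * h)) by (unfold chi, logq; f_equal; ring).
    replace (phi (logq (tau + h)%C) 0) with (phi (logq tau) (2 * iPI * h)) by (unfold phi, logq; f_equal; ring).
    reflexivity.
  - etransitivity; [|symmetry; apply dW_C]. f_equal. unfold iPI. apply injective_projections; simpl; ring.
Qed.
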